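(* Set $\mathcal{E}(X):=(C^\infty(X))^I$ with $I=(0,1]$. The following spaces of nets are equal: (i) $\{(u_\varepsilon)_{\varepsilon\in I}\in\mathcal{E}(X)\mid$ for every compact $K\subset X$ and every $P\in\mathcal{P}(X)$ there exists $N\in\mathbb{N}$ such that $\sup_{p\in K}|Pu_\varepsilon(p)|=O(\varepsilon^{-N})\}$; (ii) $\{(u_\varepsilon)_{\varepsilon\in I}\in\mathcal{E}(X)\mid$ for every compact $K\subset X$ and every $k\in\mathbb{N}_0$ there exists $N\in\mathbb{N}$ such that for all $\xi_1,\dots,\xi_k\in\mathfrak{X}(X)$, $\sup_{p\in K}|L_{\xi_1}\cdots L_{\xi_k}u_\varepsilon(p)|=O(\varepsilon^{-N})\}$; (iii) $\{(u_\varepsilon)_{\varepsilon\in I}\in\mathcal{E}(X)\mid$ for each chart $(V,\psi)$ of $X$, $(u_\varepsilon\circ\psi^{-1})_\varepsilon\in\mathcal{E}_M(\psi(V))\}$.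
   Context: $X$ is a paracompact smooth Hausdorff manifold of dimension $n$; $\mathcal{P}(X)$ is the space of linear differential operators $C^\infty(X)\to C^\infty(X)$; $\mathfrak{X}(X)$ is the space of smooth vector fields on $X$ and $L_\xi$ the Lie derivative along $\xi$. All $O$-estimates are for $\varepsilon\to0$. For $\Omega\subseteq\mathbb{R}^n$ open, $\mathcal{E}_M(\Omega)$ is the set of nets $(u_\varepsilon)_{\varepsilon\in I}\in C^\infty(\Omega)^I$ such that for every compact $K\subset\Omega$ and every multi-index $\alpha\in\mathbb{N}_0^n$ there exists $N\in\mathbb{N}$ with $\sup_{x\in K}|\partial^\alpha u_\varepsilon(x)|=O(\varepsilon^{-N})$ as $\varepsilon\to 0$. *)

(* Defs.v *)
From HB Require Import structures.
From mathcomp Require Import all_boot all_order all_algebra.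
From mathcomp Require Import all_classical all_reals all_analysis.

Set Implicit Arguments.
Unset Strict Implicit.
Unset Printing Implicit Defensive.
Import Order.TTheory GRing.Theory Num.Theory.
Import numFieldNormedType.Exports.

Local Open Scope classical_set_scope.
Local Open Scope ring_scope.

Section Euclidean.
Context {R : realType} {n : nat}.
Local Notation E := 'rV[R]_n.
Implicit Types (U : set E) (f g : E -> R).

Definition partial (i : 'I_n) f : E -> R := 'D_(delta_mx 0 i) f.

(* Iterated partial derivative of multi-index al. *)
Definition Dmulti (al : 'I_n -> nat) f : E -> R :=
  foldr (fun i g => iter (al i) (partial i) g) f (enum 'I_n).

(* Only meant for U open: the values of f outside U are then irrelevant. *)
Fixpoint Ck (k : nat) U f : Prop :=
  {in U, continuous f} /\
  if k is k'.+1 then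
    forall i, (forall x, U x -> derivable f x (delta_mx 0 i)) /\
              Ck k' U (partial i f)
  else True.

Definition smooth_on U f := forall k, Ck k U f.

Definition smooth_map_on U (F : E -> E) :=
  forall j, smooth_on U (fun x => F x 0 j).

Lemma Ck_continuous k U f : Ck k U f -> {in U, continuous f}.
Proof. by case: k => [|k] []. Qed.

Lemma CkS k U f : Ck k.+1 U f -> Ck k U f.
Proof.
elim: k f => [|k IH] f; first by case.
by move=> [cf df]; split=> // i; have [d1 d2] := df i; split=> //; exact: IH.
Qed.

Lemma Ck_ext k U f g : open U -> (forall x, U x -> f x = g x) ->
  Ck k U f -> Ck k U g.
Proof.
move=> oU; elim: k f g => [|k IH] f g fg Cf.
  split=> // x xU; have Ux := set_mem xU.
  have nfg : \forall y \near x, f y = g y.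
    by apply: filterS (open_nbhs_nbhs (conj oU Ux)) => y; exact: fg.
  rewrite /continuous_at -fg //.
  by apply: (cvg_trans _ (Ck_continuous Cf xU)); apply: near_eq_cvg nfg.
have nfg x : U x -> \forall y \near x, f y = g y.
  move=> Ux.
  by apply: filterS (open_nbhs_nbhs (conj oU Ux)) => y; exact: fg.
case: Cf => cf df; split=> [x xU|i].
  rewrite /continuous_at -fg; last exact: set_mem.
  by apply: (cvg_trans _ (cf x xU)); exact: near_eq_cvg (nfg _ (set_mem xU)).
have [d1 d2] := df i; split.
- move=> x Ux; apply: near_eq_derivable (nfg _ Ux) (d1 x Ux).
- apply: IH d2 => x Ux; apply: near_eq_derive (nfg _ Ux).
Qed.

Lemma Ck_cst k U (a : R) : Ck k U (fun=> a).
Proof.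
have cc b : {in U, continuous (fun=> b : R)}.
  by move=> x _; apply: (@cst_continuous E R b).
elim: k a => [|k IH] a; split=> // i.
split=> [x _|]; first exact: derivable_cst.
rewrite (_ : partial i _ = fun=> 0) //.
by apply/funext => x; exact: (derive_cst a).
Qed.

Lemma CkD k U f g : open U -> Ck k U f -> Ck k U g -> Ck k U (f \+ g).
Proof.
move=> oU; elim: k f g => [|k IH] f g [cf df] [cg dg].
  by split=> // x xU; exact: continuousD (cf x xU) (cg x xU).
split=> [x xU|i]; first exact: continuousD (cf x xU) (cg x xU).
have [df1 df2] := df i; have [dg1 dg2] := dg i; split=> [x Ux|].
  by apply: derivableD; [exact: df1|exact: dg1].
apply: (Ck_ext oU _ (IH _ _ df2 dg2)) => x Ux.
by rewrite /partial [RHS]deriveD; [|exact: df1|exact: dg1].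
Qed.

Lemma CkM k U f g : open U -> Ck k U f -> Ck k U g -> Ck k U (f \* g).
Proof.
move=> oU; elim: k f g => [|k IH] f g Cf Cg.
  split=> // x xU.
  exact: continuousM (Ck_continuous Cf xU) (Ck_continuous Cg xU).
split=> [x xU|i].
  exact: continuousM (Ck_continuous Cf xU) (Ck_continuous Cg xU).
have [[df1 df2] [dg1 dg2]] := (Cf.2 i, Cg.2 i); split=> [x Ux|].
  by apply: derivableM; [exact: df1|exact: dg1].
have C1 := IH _ _ (CkS Cf) dg2; have C2 := IH _ _ (CkS Cg) df2.
apply: (Ck_ext oU _ (CkD oU C1 C2)) => x Ux.
by rewrite /partial [RHS]deriveM; [|exact: df1|exact: dg1].
Qed.

Lemma smooth_on_sum U m (F : 'I_m -> E -> R) : open U ->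
  (forall i, smooth_on U (F i)) -> smooth_on U (fun x => \sum_(i < m) F i x).
Proof.
move=> oU; elim: m F => [|m IH] F sF k.
  by apply: Ck_ext (Ck_cst k U 0) => // x _; rewrite big_ord0.
apply: (Ck_ext oU _
  (CkD oU (IH (fun i => F (widen_ord (leqnSn m) i)) (fun i => sF _) k)
          (sF ord_max k))) => x _.
by rewrite big_ord_recr.
Qed.

Lemma smooth_on_partial U f i : smooth_on U f -> smooth_on U (partial i f).
Proof. by move=> sf k; have [_ /(_ i)[]] := sf k.+1. Qed.

End Euclidean.

Definition paracompact (X : topologicalType) : Prop :=
  forall C : set (set X),
    (forall U, C U -> open U) -> \bigcup_(U in C) U = [set: X] ->
  exists D : set (set X),
    [/\ forall V, D V -> open V,
        \bigcup_(V in D) V = [set: X],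
        forall V, D V -> exists2 U, C U & V `<=` U &
        forall x : X, exists2 W, nbhs x W &
          finite_set [set V | D V /\ V `&` W !=set0] ].

Section Manifold.
Context {R : realType} {n : nat}.
Local Notation E := 'rV[R]_n.

(* Only the restrictions of cmap to cdom and of cinv to cmap @` cdom are
   meaningful: (cdom, cmap) is the chart and cinv its inverse. *)
Record chart (X : topologicalType) := Chart {
  cdom : set X;
  cmap : X -> E;
  cinv : E -> X;
  cdom_open : open cdom;
  cimg_open : open (cmap @` cdom);
  cmapK : {in cdom, cancel cmap cinv};
  cmap_continuous : {in cdom, continuous cmap};
  cinv_continuous : {in cmap @` cdom, continuous cinv} }.

Definition cimg X (c : chart X) : set E := cmap c @` cdom c.

Definition compatible X (c d : chart X) :=
  smooth_map_on (cmap c @` (cdom c `&` cdom d)) (cmap d \o cinv c) /\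
  smooth_map_on (cmap d @` (cdom c `&` cdom d)) (cmap c \o cinv d).

(* Smooth structures are maximal atlases. *)
Record smooth_structure (X : topologicalType) := SmoothStructure {
  charts : set (chart X);
  charts_cover : forall p, exists2 c, charts c & cdom c p;
  charts_compatible : forall c d, charts c -> charts d -> compatible c d;
  charts_maximal : forall c,
    (forall d, charts d -> compatible c d) -> charts c }.

End Manifold.
Arguments chart R n X : clear implicits.
Arguments smooth_structure R n X : clear implicits.

Section SmoothFunctions.
Context {R : realType} {n : nat} {X : topologicalType}.
Variable A : smooth_structure R n X.
Local Notation E := 'rV[R]_n.

Definition smooth (f : X -> R) :=
  forall c, charts A c -> smooth_on (cimg c) (f \o cinv c).

Definition smooth_pred : {pred X -> R} := mem [set f | smooth f].

Record smooth_fun := SmoothFun {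
  smooth_val :> X -> R;
  _ : smooth_val \in smooth_pred }.

HB.instance Definition _ := [isSub for smooth_val].
HB.instance Definition _ := [Choice of smooth_fun by <:].

Lemma smooth_valP (f : smooth_fun) : smooth f.
Proof. by case: f => f /= /set_mem. Qed.

Lemma smooth_submod : submod_closed smooth_pred.
Proof.
split=> [|a f g /set_mem sf /set_mem sg]; apply/mem_set => c Ac k.
  exact: Ck_cst.
apply: CkD (sg c Ac k); first exact: cimg_open.
by apply: (CkM _ (Ck_cst k _ a) (sf c Ac k)); exact: cimg_open.
Qed.

Lemma smooth_mulr : mulr_closed smooth_pred.
Proof.
split=> [|f g /set_mem sf /set_mem sg]; apply/mem_set => c Ac k.
  exact: Ck_cst.
by apply: CkM (sf c Ac k) (sg c Ac k); exact: cimg_open.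
Qed.

HB.instance Definition _ :=
  GRing.isSubmodClosed.Build R (X -> R) smooth_pred smooth_submod.
HB.instance Definition _ :=
  GRing.isMulClosed.Build (X -> R) smooth_pred smooth_mulr.
HB.instance Definition _ := [SubChoice_isSubLmodule of smooth_fun by <:].
HB.instance Definition _ :=
  GRing.SubZmodule_isSubPzRing.Build _ _ smooth_fun (subringClosedP smooth_pred).
HB.instance Definition _ := GRing.SubPzRing_isSubComPzRing.Build _ _ smooth_fun.

(* f in the chart c, meaningful on cimg c *)
Definition local_repr (f : smooth_fun) (c : chart R n X) : E -> R :=
  f \o cinv c.

(* The degree-at-most-m multi-indices are encoded as the functions
   'I_n -> 'I_m.+1 of sum at most m. *)
Definition diff_op_order (m : nat) (P : {linear smooth_fun -> smooth_fun}) :=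
  forall c, charts A c ->
  exists a : {ffun 'I_n -> 'I_m.+1} -> E -> R,
    (forall al, smooth_on (cimg c) (a al)) /\
    forall (f : smooth_fun) p, cdom c p ->
      P f p = \sum_(al : {ffun 'I_n -> 'I_m.+1} | (\sum_i al i <= m)%N)
                a al (cmap c p) *
                Dmulti (fun i => al i) (local_repr f c) (cmap c p).

Definition diff_op : set {linear smooth_fun -> smooth_fun} :=
  [set P | exists m, diff_op_order m P].

Record tangent (p : X) := Tangent {
  tangent_val :> {scalar smooth_fun};
  tangent_leibniz : forall f g : smooth_fun,
    tangent_val (f * g) = f p * tangent_val g + tangent_val f * g p }.

(* Sections of the tangent bundle with smooth components in every chart. *)
Record vector_field := VectorField {
  vf_val :> forall p, tangent p;
  vf_smooth : forall c, charts A c ->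
    exists a : 'I_n -> E -> R,
      (forall i, smooth_on (cimg c) (a i)) /\
      forall p, cdom c p -> forall f : smooth_fun,
        vf_val p f =
        \sum_(i < n) a i (cmap c p) * partial i (local_repr f c) (cmap c p) }.

Lemma lie_subproof (xi : vector_field) (f : smooth_fun) :
  (fun p => xi p f) \in smooth_pred.
Proof.
apply/mem_set => c Ac; have [a [sa xiE]] := vf_smooth xi Ac.
have oc : open (cimg c) by exact: cimg_open.
have s i : smooth_on (cimg c) (a i \* partial i (local_repr f c)).
  by move=> k; apply: (CkM oc (sa i k)); exact: smooth_on_partial (smooth_valP f Ac) k.
move=> k; apply: (Ck_ext oc _ (smooth_on_sum oc s k)) => _ [p cp <-] /=.
by rewrite cmapK ?inE // xiE.
Qed.

Definition lie (xi : vector_field) (f : smooth_fun) : smooth_fun :=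
  SmoothFun (lie_subproof xi f).

End SmoothFunctions.

Section Moderate.
Context {R : realType}.

(* The index set (0, 1]. *)
Definition epsI : Type := {e : R | 0 < e <= 1}.

(* The filter of convergence to 0 on epsI. *)
Definition eps_to0 : set_system epsI :=
  [set B | \forall e \near 0^'+, forall i : epsI, val i = e -> B i].

Global Instance eps_to0_filter : ProperFilter eps_to0.
Proof.
split; last first.
  split.
  - by apply: nearW.
  - move=> P Q; rewrite /eps_to0 /=; apply: filterS2 => e Pe Qe i ie.
    by split; [exact: Pe|exact: Qe].
  - move=> P Q PQ; rewrite /eps_to0 /=; apply: filterS => e Pe i ie; exact/PQ/Pe.
move=> H.
have e01 : \forall e \near (0 : R)^'+, 0 < e <= 1.
  have := @nbhs_right_le R 0 1 ltr01.
  by apply: filterS2 (nbhs_right_gt 0) => e -> ->.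
suff /filter_ex[_ []] : \forall e \near (0 : R)^'+, False.
  by apply: filterS2 e01 H => e h He; exact: (He (exist _ e h) erefl).
Qed.

Canonical eps_to0_filterType := FilterType eps_to0 _.

(* sup is 0 on the empty set and on unbounded sets; it is only applied to
   compact K and to g continuous on K, so only the first case occurs. *)
Definition sup_norm (T : Type) (K : set T) (g : T -> R) : R :=
  sup [set `|g p| | p in K].

Definition growth_order (N : nat) (s : epsI -> R) :=
  s =O_eps_to0 (fun e => (val e) ^- N).

Definition EM_open (n : nat) (Om : set 'rV[R]_n) :
    set (epsI -> 'rV[R]_n -> R) :=
  [set u | (forall e, smooth_on Om (u e)) /\
    forall (K : set 'rV[R]_n) (al : 'I_n -> nat), compact K -> K `<=` Om ->
      exists N, growth_order N (fun e => sup_norm K (Dmulti al (u e)))].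

Section Nets.
Context {n : nat} {X : topologicalType}.
Variable A : smooth_structure R n X.

Definition net : Type := epsI -> smooth_fun A.

Definition EM_diff_op : set net :=
  [set u : net | forall (K : set X) (P : {linear smooth_fun A -> smooth_fun A}),
    compact K -> diff_op P ->
    exists N, growth_order N (fun e => sup_norm K (P (u e)))].

Definition EM_lie : set net :=
  [set u : net | forall (K : set X) (k : nat), compact K ->
    exists N, forall xi : k.-tuple (vector_field A),
      growth_order N (fun e => sup_norm K (foldr (@lie _ _ _ A) (u e) xi))].

Definition EM_chart : set net :=
  [set u : net | forall c, charts A c ->
    EM_open (cimg c) (fun e => local_repr (u e) c)].

End Nets.
End Moderate.
Arguments EM_diff_op {R n X} A.
Arguments EM_lie {R n X} A.
Arguments EM_chart {R n X} A.

(* Main.v *)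
Require Import Defs.
From HB Require Import structures.
From mathcomp Require Import all_boot all_order all_algebra.
From mathcomp Require Import all_classical all_reals all_analysis.
From mathcomp Require Import ring lra.

(** The three spaces are compared through (iii), where moderateness is a bound
    on the partial derivatives in charts.

    From charts to global operators.  Read in a chart, an operator P of order
    at most m is a sum of smooth coefficients times partial derivatives of
    order at most m.  On a closed ball inside the chart the coefficients are
    bounded, so P u is O(eps^-N), where N is the largest of the exponents
    belonging to the finitely many derivatives of u of order at most m on that
    ball.  A compact set meets only finitely many such balls
    ([compact_union_ind]).  The exponent obtained depends on the compact set
    and on m, while the coefficients of P only enter the constant
    ([EM_chart_diff_op]): the same N serves every P of order at most m.  This
    gives (i), and since a composite of k Lie derivatives is a differential
    operator of order at most k ([lie_word_diff_op]) it also gives (ii) with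
    the exponent chosen before the vector fields.

    From global operators to charts.  Around a point of a chart c choose a bump
    function chi which is 1 near the point and supported in a compact part of
    the chart.  The fields chi d_i, extended by 0, are smooth vector fields on
    X ([cutoff_field]; the extension is smooth because in a Hausdorff space the
    compact support is closed), and near the point a word in them acts as the
    corresponding iterated partial derivative ([word_partial_lie]).  Such a
    word is an admissible choice of fields in (ii), and also a differential
    operator, hence an admissible P in (i); both hypotheses therefore bound
    every partial derivative near every point of a compact subset of the chart,
    and compactness concludes ([lie_bounds_EM_chart]).

    The analysis underneath is classical: a C^1 function is differentiable
    ([C1_differentiable]), which gives the chain rule and the smoothness of
    composites ([is_derive_comp], [Ck_comp]); partial derivatives commute
    ([partial_comm]), which is what allows a word of partial derivatives to be
    rewritten as the ordered derivative of a multi-index; and the function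
    exp(-1/t) is smooth and flat at 0 ([is_derive_flat]), which gives bump
    functions. *)

Set Implicit Arguments.
Unset Strict Implicit.
Unset Printing Implicit Defensive.
Import Order.TTheory GRing.Theory Num.Theory.
Import numFieldNormedType.Exports.

Local Open Scope classical_set_scope.
Local Open Scope ring_scope.

(** * Differentiability of C^1 functions *)

Section Lines.
Context {R : realType} {V : normedModType R}.
Implicit Types (f : V -> R).

Lemma is_derive_line f (x v : V) (t : R) : derivable f (t *: v + x) v ->
  is_derive t 1 (fun s : R => f (s *: v + x)) ('D_v f (t *: v + x)).
Proof.
have E : (fun h : R => h^-1 *: (((fun s : R => f (s *: v + x)) \o shift t) (h *: 1)
             - f (t *: v + x)))
       = (fun h : R => h^-1 *: ((f \o shift (t *: v + x)) (h *: v)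
             - f (t *: v + x))).
  apply/funext => h /=; congr (_ *: (f _ - _)).
  by rewrite [h *: 1]mulr1 scalerDl addrA.
by move=> df; apply: DeriveDef; rewrite /derivable /derive /= E.
Qed.

(** The bound on t is symmetric in the sign of h, as increments along a coordinate
    axis may go either way. *)
Lemma MVT_line f (x v : V) (h : R) :
  (forall t : R, `|t| <= `|h| -> derivable f (t *: v + x) v) ->
  exists2 t : R, `|t| <= `|h| & f (h *: v + x) - f x = h * 'D_v f (t *: v + x).
Proof.
move=> df; pose g (s : R) := f (s *: v + x).
have dg (s : R) : `|s| <= `|h| -> is_derive s 1 g ('D_v f (s *: v + x)).
  by move=> sh; apply: is_derive_line; exact: df.
have cg (a b : R) : (forall s, s \in `[a, b] -> `|s| <= `|h|) ->
    {within `[a, b], continuous g}.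
  move=> H; apply: derivable_within_continuous => s sab.
  by have [] := dg s (H s sab).
have g0 : g 0 = f x by rewrite /g scale0r add0r.
have [h0|h0] := leP 0 h.
- have H s : s \in `[0, h] -> `|s| <= `|h|.
    by rewrite in_itv /= => /andP[s0 sh]; rewrite !ger0_norm.
  have dH s : s \in `]0, h[ -> is_derive s 1 g ('D_v f (s *: v + x)).
    by move=> sab; apply: dg; apply: H; exact: subset_itv_oo_cc sab.
  have [s sab E] := MVT_segment h0 dH (cg _ _ H).
  exists s; first exact: H.
  by rewrite -/(g h) -g0 E subr0 mulrC.
- have H s : s \in `[h, 0] -> `|s| <= `|h|.
    by rewrite in_itv /= => /andP[hs s0]; rewrite !ler0_norm ?lerN2 // ltW.
  have dH s : s \in `]h, 0[ -> is_derive s 1 g ('D_v f (s *: v + x)).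
    by move=> sab; apply: dg; apply: H; exact: subset_itv_oo_cc sab.
  have [s sab E] := MVT_segment (ltW h0) dH (cg _ _ H).
  exists s; first exact: H.
  rewrite -/(g h) -g0; apply: oppr_inj; rewrite opprB E.
  by rewrite sub0r mulrN mulrC.
Qed.

End Lines.

Section Grad.
Context {R : realType} {n : nat}.
Local Notation E := 'rV[R]_n.

Definition pairing (p : 'I_n -> R) (h : E) : R := \sum_j h 0 j * p j.

Lemma pairing_linear p : GRing.linear_for *:%R (pairing p : E -> R^o).
Proof.
move=> a u v; rewrite /pairing scaler_sumr -big_split /=; apply: eq_bigr => j _.
by rewrite !mxE mulrDl -mulrA.
Qed.

HB.instance Definition _ p :=
  GRing.isLinear.Build R E R^o *:%R (pairing p) (pairing_linear p).

Lemma continuous_sum (T : topologicalType) (I : Type) (r : seq I)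
    (F : I -> T -> R) x :
  (forall i, {for x, continuous (F i)}) ->
  {for x, continuous (fun y => \sum_(i <- r) F i y)}.
Proof.
move=> cF; elim: r => [|i r IH].
  rewrite (_ : (fun y => _) = fun=> 0); first exact: cvg_cst.
  by apply/funext => y; rewrite big_nil.
rewrite (_ : (fun y => _) = F i \+ (fun y => \sum_(i <- r) F i y)).
  by apply: continuousD; [exact: cF|exact: IH].
by apply/funext => y; rewrite big_cons.
Qed.

Lemma pairing_continuous p : continuous (pairing p).
Proof.
move=> x; apply: continuous_sum => j; apply: continuousM.
  exact: coord_continuous.
exact: cst_continuous.
Qed.

Lemma pairing_delta p j : pairing p (delta_mx 0 j) = p j.
Proof.
rewrite /pairing (bigD1 j) //= mxE !eqxx mul1r big1 ?addr0 // => i ij.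
by rewrite mxE eqxx (negbTE ij) mul0r.
Qed.

Lemma le_coord_norm (h : E) j : `|h 0 j| <= `|h|.
Proof.
rewrite [leRHS]/Num.Def.normr /= mx_normrE.
exact: (@le_bigmax _ _ _ 0 (fun ij : 'I_1 * 'I_n => `|h ij.1 ij.2|) (0, j)).
Qed.

Lemma norm_le_coord (h : E) (e : R) :
  0 <= e -> (forall j, `|h 0 j| <= e) -> `|h| <= e.
Proof.
move=> e0 H; rewrite [leLHS]/Num.Def.normr /= mx_normrE.
by rewrite bigmax_le //= => -[i j] _ /=; rewrite ord1.
Qed.

(** The corners of the coordinatewise path from 0 to h. *)
Definition trunc m (h : E) : E := \row_j (if (j < m)%N then h 0 j else 0).

Lemma trunc0 h : trunc 0 h = 0.
Proof. by apply/rowP => j; rewrite !mxE. Qed.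

Lemma trunc_full h : trunc n h = h.
Proof. by apply/rowP => j; rewrite !mxE ltn_ord. Qed.

Lemma truncS (m : 'I_n) h : trunc m.+1 h = h 0 m *: delta_mx 0 m + trunc m h.
Proof.
apply/rowP => j; rewrite !mxE eqxx /= ltnS leq_eqVlt -[j == m]val_eqE /=.
case: eqP => [/val_inj ->|_] /=; first by rewrite ltnn addr0 mulr1.
by rewrite mulr0 add0r.
Qed.

Lemma near0_norm_lt (d : R) : 0 < d -> \forall h \near (0 : E), `|h| < d.
Proof.
move=> d0; apply/nbhs_ballP; exists d => // h.
by rewrite -ball_normE /ball_ /= sub0r normrN.
Qed.

(** Go from x to x + h one coordinate at a time.  By the mean value theorem the
    m-th step contributes h_m times the m-th partial derivative at a point within
    |h| of x, and continuity of that derivative replaces it by its value at x. *)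
Lemma C1_increment (U : set E) (f : E -> R) x (e : R) : open U -> U x ->
  Ck 1 U f -> 0 < e ->
  \forall h \near (0 : E),
    `|f (h + x) - f x - pairing (fun j => partial j f x) h| <= e * `|h|.
Proof.
move=> oU Ux [_ df] e0.
(* There are n steps; n + 1 keeps the divisor nonzero when n = 0. *)
pose e' := e / n.+1%:R; have e'0 : 0 < e' by rewrite divr_gt0.
have near_x (Q : set E) : nbhs x Q ->
    exists2 d : R, 0 < d & forall k : E, `|k| < d -> Q (k + x).
  move=> /nbhs_ballP[d /= d0 dQ]; exists d => // k kd; apply: dQ.
  by rewrite -ball_normE /ball_ /= opprD addrCA subrr addr0 normrN.
have [d d0 dU] := near_x _ (open_nbhs_nbhs (conj oU Ux)).
have key j : \forall k \near (0 : E), `|partial j f (k + x) - partial j f x| <= e'.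
  have [_ [cj _]] := df j.
  have /cvgrPdist_le /(_ e' e'0) /near_x[c c0 cP] := cj x (mem_set Ux).
  apply/nbhs_ballP; exists c => // k; rewrite -ball_normE /ball_ /= sub0r normrN.
  by move=> /cP; rewrite distrC.
have /nbhs_ballP[c /= c0 cP] := @filter_forall E 'I_n
  (fun j k => `|partial j f (k + x) - partial j f x| <= e') _
  (nbhs_filter (0 : E)) key.
near=> h.
have hd : `|h| < d by near: h; exact: near0_norm_lt.
have hc : `|h| < c by near: h; exact: near0_norm_lt.
have tn (m : 'I_n) (t : R) : `|t| <= `|h 0 m| ->
    `|t *: delta_mx 0 m + trunc m h| <= `|h|.
  move=> th; apply: norm_le_coord => // j; rewrite !mxE eqxx /= -val_eqE /=.
  case: eqP => [/val_inj ->|_].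
    by rewrite ltnn addr0 mulr1 (le_trans th) // le_coord_norm.
  by rewrite mulr0 add0r; case: ifP => _; rewrite ?normr0 // le_coord_norm.
have step (m : 'I_n) :
    `|f (trunc m.+1 h + x) - f (trunc m h + x) - h 0 m * partial m f x| <= e' * `|h|.
  rewrite truncS -[_ *: _ + _ + x]addrA.
  have dl (t : R) : `|t| <= `|h 0 m| ->
      derivable f (t *: delta_mx 0 m + (trunc m h + x)) (delta_mx 0 m).
    move=> th; apply: (df m).1; rewrite addrA; apply: dU.
    exact: le_lt_trans (tn m t th) hd.
  have [t th ->] := MVT_line dl.
  rewrite -mulrBr normrM mulrC; apply: ler_pM => //; last exact: le_coord_norm.
  rewrite addrA; apply: (cP (t *: delta_mx 0 m + trunc m h)).
  by rewrite -ball_normE /ball_ /= sub0r normrN (le_lt_trans (tn m t th)).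
have -> : f (h + x) - f x - pairing (fun j => partial j f x) h =
   \sum_(m < n) (f (trunc m.+1 h + x) - f (trunc m h + x) - h 0 m * partial m f x).
  rewrite big_split /= sumrN; congr (_ - _).
  rewrite -(big_mkord xpredT (fun m => f (trunc m.+1 h + x) - f (trunc m h + x))).
  by rewrite (telescope_sumr (fun m => f (trunc m h + x))) // trunc_full trunc0 add0r.
apply: le_trans (ler_norm_sum _ _ _) _.
apply: (@le_trans _ _ (\sum_(m < n) e' * `|h|)); first exact: ler_sum.
rewrite sumr_const card_ord -mulrnAl ler_wpM2r // /e' -mulr_natr mulrAC.
by rewrite ler_pdivrMr // ler_pM2l // ler_nat.
Unshelve. all: by end_near. Qed.

Lemma C1_expansion (U : set E) (f : E -> R) x : open U -> U x -> Ck 1 U f ->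
  (f \o shift x : E -> R^o) =
    cst (f x) + (pairing (fun j => partial j f x) : E -> R^o) +o_ (0 : E) id.
Proof.
move=> oU Ux Cf; apply/eqaddoP => e e0; near=> h.
rewrite opprD addrA.
rewrite -[X in X h]/(fun h => f (h + x) - f x -
  pairing (fun j => partial j f x) h) /=.
by near: h; apply: (C1_increment oU Ux Cf).
Unshelve. all: by end_near. Qed.

Lemma C1_differential (U : set E) (f : E -> R) x : open U -> U x ->
  Ck 1 U f -> 'd f x = pairing (fun j => partial j f x) :> (E -> R).
Proof.
move=> oU Ux Cf; apply: diff_unique; first exact: pairing_continuous.
exact: C1_expansion oU Ux Cf.
Qed.

Lemma C1_differentiable (U : set E) (f : E -> R) x : open U -> U x ->
  Ck 1 U f -> differentiable f x.
Proof.
move=> oU Ux Cf; apply/diff_locallyP.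
rewrite (C1_differential oU Ux Cf); split; first exact: pairing_continuous.
exact: C1_expansion oU Ux Cf.
Qed.

End Grad.

(** * Chain rule, smoothness of composites, symmetry of second derivatives *)

Section Calculus.
Context {R : realType} {n : nat}.
Local Notation E := 'rV[R]_n.
Implicit Types (U V : set E) (f g : E -> R).

Lemma derivable_shift f (a x v : E) : derivable f (x + a) v ->
  derivable (fun y => f (y + a)) x v.
Proof.
rewrite /derivable (_ : (fun h => _) = fun h : R =>
  h^-1 *: (((fun y => f (y + a)) \o shift x) (h *: v) - f (x + a))) //.
by apply/funext => h /=; rewrite addrA.
Qed.

Lemma derive_shift_pt f (a x v : E) :
  'D_v (fun y => f (y + a)) x = 'D_v f (x + a).
Proof.
rewrite /derive (_ : (fun h => _) = fun h : R =>
  h^-1 *: ((f \o shift (x + a)) (h *: v) - f (x + a))) //.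
by apply/funext => h /=; rewrite addrA.
Qed.

Lemma continuous_rowP (T : topologicalType) (F : T -> E) x :
  (forall j, {for x, continuous (fun y => F y 0 j)}) -> {for x, continuous F}.
Proof.
move=> cF A [P /= nP sPA].
have := @filter_forall T 'I_n (fun j y => P 0 j (F y 0 j)) _ (nbhs_filter x)
  (fun j => cF j _ (nP 0 j)).
by apply: filterS => y Py; apply: sPA => i j; rewrite ord1.
Qed.

(** Restricted to the line through x in direction v this is the chain rule for
    the curve t |-> F (t v + x), so F only needs its derivative along v, whereas
    g has to be differentiable in all directions at once. *)
Lemma is_derive_comp U g (F : E -> E) (x v : E) : open U -> U (F x) ->
  Ck 1 U g -> (forall j, derivable (fun y => F y 0 j) x v) ->
  is_derive x v (g \o F) (\sum_j 'D_v (fun y => F y 0 j) x * partial j g (F x)).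
Proof.
move=> oU Ux Cg dF.
pose c (t : R) : E := F (t *: v + x).
have c0 : c 0 = F x by rewrite /c scale0r add0r.
have line (W : normedModType R) (h : E -> W) : derivable h x v ->
    is_derive (0 : R) 1 (fun t : R => h (t *: v + x)) ('D_v h x).
  have Q : (fun t : R => t^-1 *: (((fun s : R => h (s *: v + x)) \o shift 0) (t *: 1)
             - h (0 *: v + x)))
       = (fun t : R => t^-1 *: ((h \o shift x) (t *: v) - h x)).
    by apply/funext => t /=; rewrite [t *: 1]mulr1 scale0r add0r addr0.
  by move=> dh; apply: DeriveDef; rewrite /derivable /derive /= Q.
have dFx : derivable F x v by apply/derivable_mxP => i j; rewrite ord1; exact: dF.
have dc : is_derive (0 : R) 1 c ('D_v F x) := line _ _ dFx.
have diffc : differentiable c (0 : R) by apply/derivable1_diffP; case: dc.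
have diffg : differentiable g (c 0) by rewrite c0; exact: C1_differentiable Cg.
have diffgc : differentiable (g \o c) (0 : R) by exact: differentiable_comp.
have dgF : derivable (g \o F) x v by apply/derivable1P/derivable1_diffP.
apply: DeriveDef => //; have [_ <-] := line _ _ dgF.
rewrite (deriveE _ diffgc) diff_comp // /= c0 (C1_differential oU Ux Cg).
have [_] := dc; rewrite (deriveE _ diffc) => ->; rewrite derive_mx //.
by apply: eq_bigr => j _; rewrite mxE.
Qed.

Lemma Ck_sub k U V f : V `<=` U -> Ck k U f -> Ck k V f.
Proof.
move=> VU; elim: k f => [|k IH] f [cf df]; split=> //.
- by move=> x /set_mem/VU/mem_set; exact: cf.
- by move=> x /set_mem/VU/mem_set; exact: cf.
- move=> i; have [d1 d2] := df i; split; last exact: IH.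
  by move=> x /VU; exact: d1.
Qed.

(** Used to glue a smooth function with its extension by 0. *)
Lemma Ck_local k U f :
  (forall x, U x -> exists V, [/\ open V, V x & Ck k V f]) -> Ck k U f.
Proof.
elim: k f => [|k IH] f H.
  split=> // x /set_mem/H[V [_ Vx [cf _]]].
  exact/cf/mem_set.
split=> [x /set_mem/H[V [_ Vx [cf _]]]|i]; first exact/cf/mem_set.
split=> [x /H[V [_ Vx [_ /(_ i)[+ _]]]]|]; first exact.
by apply: IH => x /H[V [oV Vx [_ /(_ i)[_ C]]]]; exists V.
Qed.

Lemma Ck_sum k U (I : Type) (r : seq I) (P : pred I) (F : I -> E -> R) : open U ->
  (forall i, P i -> Ck k U (F i)) -> Ck k U (fun x => \sum_(i <- r | P i) F i x).
Proof.
move=> oU CF; elim: r => [|i r IH].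
  by apply: Ck_ext (Ck_cst k U 0) => // x _; rewrite big_nil.
case Pi: (P i); last by apply: (Ck_ext oU _ IH) => x _; rewrite big_cons Pi.
apply: (Ck_ext oU _ (CkD oU (CF i Pi) IH)) => x _ /=.
by rewrite big_cons Pi.
Qed.

Lemma Ck_comp k U V g (F : E -> E) : open U -> open V ->
  (forall x, U x -> V (F x)) -> (forall j, Ck k U (fun x => F x 0 j)) ->
  Ck k V g -> Ck k U (g \o F).
Proof.
move=> oU oV UV; elim: k g => [|k IH] g CF Cg.
  split=> // x xU; apply: continuous_comp.
    by apply: continuous_rowP => j; exact: (CF j).1.
  exact/(Ck_continuous Cg)/mem_set/UV/set_mem.
split=> [x xU|i].
  apply: continuous_comp.
    by apply: continuous_rowP => j; exact: (CF j).1.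
  exact/(Ck_continuous Cg)/mem_set/UV/set_mem.
have C1 : Ck 1 V g.
  split; first exact: Ck_continuous Cg.
  move=> j; have [d1 d2] := Cg.2 j; split=> //.
  by split=> //; exact: Ck_continuous d2.
have D x : U x -> is_derive x (delta_mx 0 i) (g \o F)
    (\sum_j partial i (fun y => F y 0 j) x * partial j g (F x)).
  move=> Ux; apply: (is_derive_comp oV (UV _ Ux) C1) => j.
  exact: ((CF j).2 i).1.
split=> [x Ux|]; first by have [] := D x Ux.
pose dgF x := \sum_j partial i (fun y => F y 0 j) x * partial j g (F x).
apply: (@Ck_ext _ _ _ _ dgF) => //.
  by move=> x Ux; rewrite /dgF; have [_ <-] := D x Ux.
apply: Ck_sum => // j _; apply: (CkM oU ((CF j).2 i).2).
by apply: IH; [move=> l; exact: CkS (CF l) | exact: (Cg.2 j).2].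
Qed.

Lemma CkV k U f : open U -> (forall x, U x -> f x != 0) -> Ck k U f ->
  Ck k U (fun x => (f x)^-1).
Proof.
move=> oU f0; elim: k f f0 => [|k IH] f f0 Cf.
  split=> // x xU.
  by apply: continuousV; [exact: f0 _ (set_mem xU)|exact: Ck_continuous Cf _ xU].
split=> [x xU|i].
  by apply: continuousV; [exact: f0 _ (set_mem xU)|exact: Ck_continuous Cf _ xU].
have [d1 d2] := Cf.2 i; have CV := IH f f0 (CkS Cf).
split=> [x Ux|]; first by apply: derivableV; [exact: f0|exact: d1].
apply: (Ck_ext oU _ (CkM oU (Ck_cst k U (-1)) (CkM oU (CkM oU CV CV) d2))).
move=> x Ux; rewrite /partial deriveV; [|exact: f0|exact: d1].
by rewrite /= mulN1r -mulNr -invfM -expr2.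
Qed.

(** A smooth function of one variable enters as the sequence H of its successive
    derivatives, which makes the induction on k immediate: a partial derivative of
    H_m composed with f is H_(m+1) composed with f, times one of f. *)
Lemma Ck_comp_tower (H : nat -> R -> R) :
  (forall m (t : R), is_derive t 1 (H m) (H m.+1 t)) ->
  forall k m U f, open U -> Ck k U f -> Ck k U (fun x => H m (f x)).
Proof.
move=> dH.
have cH m : continuous (H m).
  move=> t; apply: differentiable_continuous; apply/derivable1_diffP.
  by have [] := dH m t.
elim=> [|k IH] m U f oU Cf.
  split=> // x xU; apply: continuous_comp; last exact: cH.
  exact: Ck_continuous Cf _ xU.
split=> [x xU|i].
  by apply: continuous_comp; [exact: Ck_continuous Cf _ xU|exact: cH].
have [d1 d2] := Cf.2 i.
have D x : U x ->
    is_derive x (delta_mx 0 i) (H m \o f) (partial i f x * H m.+1 (f x)).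
  move=> Ux; pose c (t : R) := f (t *: delta_mx 0 i + x).
  have c0 : c 0 = f x by rewrite /c scale0r add0r.
  have dc : is_derive (0 : R) 1 c (partial i f x).
    have := @is_derive_line _ _ f x (delta_mx 0 i) 0.
    by rewrite scale0r add0r; apply; exact: d1.
  have dHc : is_derive (c 0) 1 (H m) (H m.+1 (f x)) by rewrite c0; exact: dH.
  have [dd Dd] := is_derive1_comp dHc dc.
  have dHf : derivable (H m \o f) x (delta_mx 0 i) by apply/derivable1P.
  apply: DeriveDef => //; rewrite mulrC -Dd.
  have := @is_derive_line _ _ (H m \o f) x (delta_mx 0 i) 0.
  by rewrite scale0r add0r => /(_ dHf)[_ <-].
split=> [x Ux|]; first by have [] := D x Ux.
apply: (Ck_ext oU _ (CkM oU d2 (IH m.+1 U f oU (CkS Cf)))) => x Ux /=.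
by have [_ <-] := D x Ux.
Qed.

(** The second difference of f over a square of side h, divided by h^2, is a value
    of the mixed derivative at a nearby point: apply the mean value theorem along
    e_i to y |-> f (y + h e_j) - f y, and then along e_j. *)
Lemma mixed_increment U f x i j (h : R) : Ck 2 U f ->
  (forall k : E, `|k| <= `|h| *+ 2 -> U (k + x)) ->
  exists2 k : E, `|k| <= `|h| *+ 2 &
    f (h *: delta_mx 0 i + (h *: delta_mx 0 j + x)) - f (h *: delta_mx 0 i + x)
      - f (h *: delta_mx 0 j + x) + f x = h * h * partial j (partial i f) (k + x).
Proof.
move=> Cf HU; pose ei : E := delta_mx 0 i; pose ej : E := delta_mx 0 j.
have nd l (t : R) : `|t| <= `|h| -> `|t *: delta_mx 0 l : E| <= `|h|.
  move=> th; apply: norm_le_coord => // l'; rewrite !mxE eqxx /=.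
  by case: eqP => _; rewrite ?mulr1 // mulr0 normr0.
have nd2 (t s : R) : `|t| <= `|h| -> `|s| <= `|h| ->
    `|t *: ej + s *: ei| <= `|h| *+ 2.
  by move=> th sh; rewrite (le_trans (ler_normD _ _)) // mulr2n lerD ?nd.
have U2 (t s : R) : `|t| <= `|h| -> `|s| <= `|h| -> U (t *: ej + (s *: ei + x)).
  by move=> th sh; rewrite addrA; apply: HU; exact: nd2.
have z : `|0 : R| <= `|h| by rewrite normr0.
pose phi y := f (y + h *: ej) - f y.
have dphi (s : R) : `|s| <= `|h| -> is_derive (s *: ei + x) ei phi
    (partial i f (h *: ej + (s *: ei + x)) - partial i f (s *: ei + x)).
  move=> sh.
  have d1 : derivable (fun y => f (y + h *: ej)) (s *: ei + x) ei.
    by apply: derivable_shift; rewrite addrC; exact/(Cf.2 i).1/U2.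
  have d2 : derivable f (s *: ei + x) ei.
    by apply: (Cf.2 i).1; have := U2 0 s z sh; rewrite scale0r add0r.
  have := is_deriveB (derivableP d1) (derivableP d2).
  by rewrite derive_shift_pt [s *: ei + x + _]addrC.
have [s sh Es] : exists2 s : R, `|s| <= `|h| &
    phi (h *: ei + x) - phi x = h * 'D_ei phi (s *: ei + x).
  by apply: MVT_line => s sh; have [] := dphi s sh.
have [t th Et] : exists2 t : R, `|t| <= `|h| &
    partial i f (h *: ej + (s *: ei + x)) - partial i f (s *: ei + x) =
    h * partial j (partial i f) (t *: ej + (s *: ei + x)).
  by apply: MVT_line => t th; exact/((Cf.2 i).2.2 j).1/U2.
exists (t *: ej + s *: ei); first exact: nd2.
rewrite -[_ + _ + x]addrA -mulrA -Et; have [_ <-] := dphi s sh.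
rewrite -Es /phi -/ei -/ej.
have -> : h *: ei + x + h *: ej = h *: ei + (h *: ej + x).
  by rewrite -addrA [x + _]addrC.
by rewrite [x + h *: ej]addrC; ring.
Qed.

Lemma dist_le_half (z p q e : R) :
  `|p - z| <= e / 2 -> `|q - z| <= e / 2 -> `|p - q| <= e.
Proof.
move=> pz qz; rewrite -(subrKA z) (le_trans (ler_normD _ _)) //.
by rewrite [leRHS]splitr lerD // distrC.
Qed.

(** The second difference is symmetric in i and j, so [mixed_increment] makes both
    mixed derivatives take a common value at points arbitrarily close to x. *)
Lemma partial_comm U f x i j : open U -> U x -> Ck 2 U f ->
  partial i (partial j f) x = partial j (partial i f) x.
Proof.
move=> oU Ux Cf; apply/eqP; rewrite -subr_eq0 -normr_le0.
apply/ler_addgt0Pr => e e0; rewrite add0r.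
have near_x i' j' : \forall y \near x,
    `|partial i' (partial j' f) x - partial i' (partial j' f) y| <= e / 2.
  have [c _] := ((Cf.2 j').2.2 i').2.
  by have /cvgrPdist_le := c x (mem_set Ux); apply; rewrite divr_gt0.
have : \forall y \near x, [/\ U y,
    `|partial i (partial j f) x - partial i (partial j f) y| <= e / 2 &
    `|partial j (partial i f) x - partial j (partial i f) y| <= e / 2].
  apply: filterS3 (open_nbhs_nbhs (conj oU Ux)) (near_x i j) (near_x j i).
  by move=> y *; split.
move=> /nbhs_ballP[d /= d0 dP].
(* The sample points lie within 2 h of x, hence in the ball of radius d. *)
pose h := d / 4.
have h0 : 0 < h by rewrite divr_gt0.
have hd k : `|k| <= `|h| *+ 2 -> ball x d (k + x).
  move=> kh; rewrite -ball_normE /ball_ /= opprD addrCA subrr addr0 normrN.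
  apply: le_lt_trans kh _; rewrite gtr0_norm // /h -mulr_natr.
  lra.
have HU k : `|k| <= `|h| *+ 2 -> U (k + x) by move=> /hd /dP[].
have [k1 k1h E1] := mixed_increment i j Cf HU.
have [k2 k2h E2] := mixed_increment j i Cf HU.
have [_ _ A1] := dP _ (hd _ k1h); have [_ A2 _] := dP _ (hd _ k2h).
have E12 : partial j (partial i f) (k1 + x) = partial i (partial j f) (k2 + x).
  apply: (@mulfI _ (h * h)); first by rewrite mulf_neq0 // gt_eqF.
  apply: etrans (esym E1) _; apply: etrans _ E2.
  rewrite addrCA; congr (_ + _); exact: addrAC.
by rewrite E12 in A1; exact: dist_le_half A2 A1.
Qed.

End Calculus.

(** * Bump functions *)

Section Flat.
Context {R : realType}.

Lemma scaleRE (a b : R) : a *: b = a * b.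
Proof. by []. Qed.

(** The polynomials P_m for which the m-th derivative of exp(-1/t) on t > 0 is
    P_m(1/t) exp(-1/t). *)
Fixpoint flat_poly (m : nat) : {poly R} :=
  if m is m'.+1 then 'X^2 * (flat_poly m' - (flat_poly m')^`()) else 1.

Definition flat (m : nat) (t : R) : R :=
  if 0 < t then (flat_poly m).[t^-1] * expR (- t^-1) else 0.

(** Each monomial s^k is at most k! exp(s), by the exponential series. *)
Lemma poly_expRN_bounded (p : {poly R}) :
  exists C, forall s, 0 <= s -> `|p.[s] * expR (- s)| <= C.
Proof.
exists (\sum_(i < size p) `|p`_i| * i`!%:R) => s s0.
rewrite normrM (ger0_norm (expR_ge0 _)) horner_coef.
apply: le_trans (_ : \sum_(i < size p) `|p`_i * s ^+ i| * expR (- s) <= _).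
  by rewrite -mulr_suml ler_wpM2r ?expR_ge0 // ler_norm_sum.
apply: ler_sum => i _; rewrite normrM -mulrA ler_wpM2l //.
rewrite ger0_norm ?exprn_ge0 // expRN ler_pdivrMr ?expR_gt0 //.
case: (nat_of_ord i) => [|k].
  by rewrite expr0 fact0 mul1r (le_trans _ (expR_ge1Dx s)) // lerDl.
have := expR_ge1Dxn k s0; set F := (k.+1)`!%:R => H.
have F0 : 0 < F by rewrite ltr0n fact_gt0.
rewrite -ler_pdivrMl // mulrC (le_trans _ H) // lerDr.
exact: ler01.
Qed.

Lemma flat_le0 m t : t <= 0 -> flat m t = 0.
Proof. by rewrite /flat leNgt; case: (0 < t). Qed.

Lemma flat0_gt0 t : 0 < t -> 0 < flat 0 t.
Proof. by rewrite /flat => ->; rewrite hornerC mul1r expR_gt0. Qed.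

Lemma flat0_ge0 t : 0 <= flat 0 t.
Proof.
by have [/flat_le0 ->|/flat0_gt0/ltW] := leP t 0.
Qed.

(** With s = 1/t this says that s^2 P_m(s) exp(-s) is bounded.  It is what makes
    every derivative of [flat] vanish at 0. *)
Lemma flat_quadratic m : exists C, forall t : R, `|flat m t| <= C * t ^+ 2.
Proof.
have [C HC] := poly_expRN_bounded ('X^2 * flat_poly m); exists `|C| => t.
have C0 : 0 <= `|C| * t ^+ 2 by rewrite mulr_ge0 ?sqr_ge0.
rewrite /flat; case: ltP => t0; last by rewrite normr0.
have t1 : 0 <= t^-1 by rewrite invr_ge0 ltW.
have := le_trans (HC _ t1) (ler_norm C).
rewrite hornerM hornerXn -mulrA normrM (ger0_norm (sqr_ge0 _)) exprVn.
by rewrite ler_pdivrMl ?exprn_gt0 // [leRHS]mulrC.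
Qed.

Lemma is_derive_flat m (t : R) : is_derive t 1 (flat m) (flat m.+1 t).
Proof.
have [t0|t0|<-] := ltgtP 0 t.
- pose G s := (flat_poly m).[s] * expR (- s).
  have dV : is_derive t 1 (fun s : R => s^-1) (- t ^- 2).
    have tN0 : t != 0 by rewrite gt_eqF.
    apply: DeriveDef; first by apply: derivableV => //; exact: derivable_id.
    rewrite (@deriveV _ _ id t 1 tN0 (@derivable_id _ _ _ _)) derive_id.
    by exact: mulr1.
  have dG (s : R) :
      is_derive s 1 G (((flat_poly m)^`() - flat_poly m).[s] * expR (- s)).
    have d1 : is_derive s 1 (fun s => expR (- s)) (expR (- s) * -1).
      exact: (@is_derive1_comp _ expR -%R).
    have := @is_deriveM _ _ (horner (flat_poly m)) _ s 1 _ _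
      (is_derive_poly _ _) d1.
    move=> H; apply: trigger_derive.
    by rewrite !scaleRE hornerD hornerN; ring.
  have D : is_derive t 1 (G \o (fun s : R => s^-1)) (flat m.+1 t).
    apply: trigger_derive; rewrite /flat t0 /= hornerM hornerXn !hornerE exprVn.
    by ring.
  apply: near_eq_is_derive D.
  by near=> s; rewrite /G /flat /=; have -> : 0 < s by near: s; exact: lt_nbhsr.
- have D : is_derive t 1 (fun=> 0 : R) (flat m.+1 t).
    by rewrite flat_le0 ?ltW //; exact: is_derive_cst.
  apply: near_eq_is_derive D.
  by near=> s; rewrite flat_le0 // ltW //; near: s; exact: lt_nbhsl.
(* At 0 the difference quotient is at most C |h|. *)
- have [C HC] := flat_quadratic m.
  have L : (fun h : R => h^-1 *: ((flat m \o shift 0) (h *: 1) - flat m 0))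
      @ 0^' --> (0 : R).
    apply/cvgrPdist_le => e e0; near=> h.
    have hN0 : h != 0 by near: h; exact: nbhs_dnbhs_neq.
    rewrite sub0r normrN /= addr0 [h *: 1]mulr1 (flat_le0 m (lexx 0)) subr0.
    rewrite scaleRE normrM normfV ler_pdivrMl ?normr_gt0 //.
    apply: le_trans (HC h) _; rewrite -real_normK ?num_real // expr2 mulrA mulrC.
    rewrite ler_wpM2l //.
    apply: (@le_trans _ _ ((`|C| + 1) * `|h|)).
      by rewrite ler_wpM2r // (le_trans (ler_norm C)) // lerDl.
    rewrite -ler_pdivlMl; last by rewrite ltr_wpDl.
    near: h; apply: dnbhs0_le; rewrite mulrC divr_gt0 // ltr_wpDl //.
  apply: DeriveDef; first by apply/cvg_ex; exists 0.
  by rewrite (flat_le0 _ (lexx 0)); exact: cvg_lim L.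
Unshelve. all: by end_near. Qed.

End Flat.

Section Bump.
Context {R : realType} {n : nat}.
Local Notation E := 'rV[R]_n.

Lemma Ck_pairing k U (p : 'I_n -> R) : Ck k U (pairing p : E -> R).
Proof.
have d x : differentiable (pairing p : E -> R) x.
  by apply: linear_differentiable; exact: pairing_continuous.
case: k => [|k]; first by split=> // x _; exact: pairing_continuous.
split=> [x _|i]; first exact: pairing_continuous.
split=> [x _|]; first exact: diff_derivable.
rewrite (_ : partial i _ = fun=> p i); first exact: Ck_cst.
apply/funext => x; rewrite /partial deriveE // diff_lin.
  exact: pairing_delta.
exact: pairing_continuous.
Qed.

Lemma Ck_coord k U (j : 'I_n) : Ck k U (fun x : E => x 0 j).
Proof.
rewrite (_ : (fun x : E => x 0 j) = pairing (fun i => (i == j)%:R)).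
  exact: Ck_pairing.
apply/funext => x; rewrite /pairing (bigD1 j) //= eqxx mulr1 big1 ?addr0 //.
by move=> i /negbTE ->; rewrite mulr0.
Qed.

(** With s(y) = 2 |y - x|_2^2 / r^2 and g = [flat 0], take
    chi = g(2 - s) / (g(2 - s) + g(s - 1)).  It is 1 where s <= 1 and 0 where
    s >= 2; the denominator never vanishes since s < 2 or s > 1. *)
Lemma exists_bump (x : E) (r : R) : 0 < r ->
  exists chi : E -> R, [/\ smooth_on setT chi,
    \forall y \near x, chi y = 1 &
    forall y, chi y != 0 -> `|y - x| <= r].
Proof.
move=> r0.
pose s (y : E) := \sum_j (2 / r ^+ 2) * ((y 0 j - x 0 j) * (y 0 j - x 0 j)).
have Cs k : Ck k setT s.
  apply: Ck_sum => [|j _]; first exact: openT.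
  apply: CkM; [exact: openT|exact: Ck_cst|].
  have C1 : Ck k setT (fun y : E => y 0 j - x 0 j).
    by apply: CkD; [exact: openT|exact: Ck_coord|exact: Ck_cst].
  by apply: (CkM _ C1 C1); exact: openT.
pose a y := flat 0 (2 - s y); pose b y := flat 0 (s y - 1).
have ab0 y : a y + b y != 0.
  rewrite gt_eqF // /a /b; have [s2|s2] := ltP (s y) 2.
    by rewrite ltr_wpDr ?flat0_ge0 // flat0_gt0 // subr_gt0.
  rewrite ltr_wpDl ?flat0_ge0 // flat0_gt0 // subr_gt0.
  by rewrite (lt_le_trans _ s2) // ltr1n.
have Ca k : Ck k setT a.
  apply: (Ck_comp_tower is_derive_flat) => //; first exact: openT.
  apply: CkD; [exact: openT|exact: Ck_cst|].
  rewrite (_ : (fun y => - s y) = (fun=> -1) \* s); last first.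
    by apply/funext => y /=; rewrite mulN1r.
  by apply: CkM; [exact: openT|exact: Ck_cst|exact: Cs].
have Cb k : Ck k setT b.
  apply: (Ck_comp_tower is_derive_flat) => //; first exact: openT.
  by apply: CkD; [exact: openT|exact: Cs|exact: Ck_cst].
exists (fun y => a y / (a y + b y)); split.
- move=> k; apply: CkM => //; first exact: openT.
  apply: CkV => //; first exact: openT.
  by apply: CkD => //; exact: openT.
- have /(_ x) cs : continuous s by move=> y; apply: (Cs 0%N).1; rewrite inE.
  have sx : s x = 0 by rewrite /s big1 // => j _; rewrite subrr !mulr0.
  have : \forall y \near x, s y < 1.
    by have /cvgr_lt/(_ 1) := cs; rewrite sx; apply; exact: ltr01.
  apply: filterS => y sy; rewrite /a /b [flat 0 (s y - 1)]flat_le0 ?addr0.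
    by rewrite divff // gt_eqF // flat0_gt0 // subr_gt0 (lt_trans sy) // ltr1n.
  by rewrite subr_le0 ltW.
- move=> y; have [s2|s2] := ltP (s y) 2; last first.
    by rewrite /a flat_le0 ?mul0r ?eqxx // subr_le0.
  move=> _; apply: norm_le_coord; first exact: ltW.
  move=> j; rewrite !mxE.
  have sj : (2 / r ^+ 2) * ((y 0 j - x 0 j) * (y 0 j - x 0 j)) <= s y.
    rewrite /s (bigD1 j) //= lerDl sumr_ge0 // => i _.
    by rewrite mulr_ge0 ?divr_ge0 ?sqr_ge0 ?ltW // -expr2 sqr_ge0.
  have := le_lt_trans sj s2; rewrite -mulrA gtr_pMr // mulrC -expr2.
  rewrite ltr_pdivrMr ?exprn_gt0 // mul1r => H.
  by rewrite -ler_sqr ?nnegrE ?(ltW r0) // real_normK ?num_real // ltW.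
Qed.

End Bump.

(** * Words of partial derivatives and local differential operators *)

Section Words.
Context {R : realType} {n : nat}.
Local Notation E := 'rV[R]_n.
Implicit Types (U V : set E) (f g : E -> R) (w : seq 'I_n).

Definition word_partial w f : E -> R := foldr partial f w.

Lemma word_partial_cat w w' f :
  word_partial (w ++ w') f = word_partial w (word_partial w' f).
Proof. exact: foldr_cat. Qed.

Lemma Dmulti_word (al : 'I_n -> nat) f :
  Dmulti al f = word_partial (flatten [seq nseq (al i) i | i <- enum 'I_n]) f.
Proof.
rewrite /Dmulti /word_partial; elim: (enum 'I_n) => //= i r ->.
rewrite foldr_cat; elim: (al i) => //= k ->.
by [].
Qed.

Lemma word_smooth U w f : smooth_on U f -> smooth_on U (word_partial w f).
Proof. by move=> sf; elim: w => //= i w; exact: smooth_on_partial. Qed.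

Lemma word_germ V w f g : open V -> (forall x, V x -> f x = g x) ->
  forall x, V x -> word_partial w f x = word_partial w g x.
Proof.
move=> oV fg; elim: w => //= i w IH x Vx; apply: near_eq_derive.
by apply: filterS (open_nbhs_nbhs (conj oV Vx)) => y; exact: IH.
Qed.

(** Schwarz's theorem, moving d_i past one letter of the word at a time. *)
Lemma word_partialC U i w f : open U -> smooth_on U f ->
  forall x, U x -> partial i (word_partial w f) x = word_partial w (partial i f) x.
Proof.
move=> oU sf; elim: w => //= j w IH x Ux.
rewrite (partial_comm i j oU Ux (word_smooth w sf 2%N)).
apply: near_eq_derive.
by apply: filterS (open_nbhs_nbhs (conj oU Ux)) => y; exact: IH.
Qed.

Lemma word_partial_perm U w w' f : open U -> smooth_on U f -> perm_eq w w' ->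
  forall x, U x -> word_partial w f x = word_partial w' f x.
Proof.
move=> oU; elim: w w' f => [|i w IH] w' f sf.
  by rewrite perm_sym => /perm_nilP ->.
move=> pw x Ux.
have iw' : i \in w' by rewrite -(perm_mem pw) mem_head.
have [u [v w'E]] : exists u v, w' = u ++ i :: v.
  exists (take (index i w') w'), (drop (index i w').+1 w').
  by rewrite -drop_index // cat_take_drop.
move: pw; rewrite w'E perm_sym perm_catC /= perm_cons perm_catC perm_sym => pw.
transitivity (word_partial (i :: u ++ v) f x).
  apply: near_eq_derive.
  by apply: filterS (open_nbhs_nbhs (conj oU Ux)) => y; exact: IH.
rewrite /= (word_partialC i (u ++ v) oU sf Ux).
rewrite !word_partial_cat; apply: (word_germ u oU _ Ux) => y Uy.
exact: esym (word_partialC i v oU sf Uy).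
Qed.

(** [Dmulti] orders the derivatives by index, so the new d_i has to be moved to its
    place among the others. *)
Lemma partial_Dmulti U i (al : 'I_n -> nat) f : open U -> smooth_on U f ->
  forall x, U x ->
    partial i (Dmulti al f) x = Dmulti (fun j => (al j + (j == i))%N) f x.
Proof.
move=> oU sf x Ux; rewrite !Dmulti_word.
apply: (@word_partial_perm U (i :: _) _ f oU sf _ x Ux).
apply/allP => j _ /=; apply/eqP.
have cnt (be : 'I_n -> nat) :
    count_mem j (flatten [seq nseq (be l) l | l <- enum 'I_n]) = be j.
  rewrite count_flatten -map_comp sumnE big_map big_enum /= (bigD1 j) //=.
  rewrite count_nseq /= eqxx mul1n big1 ?addn0 // => l lj.
  by rewrite count_nseq /= (negbTE lj).
by rewrite !cnt addnC (eq_sym i).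
Qed.

End Words.

Section LocalDiffOp.
Context {R : realType} {n : nat}.
Local Notation E := 'rV[R]_n.
Variable U : set E.
Hypothesis oU : open U.
Implicit Types (f g : E -> R) (Q : (E -> R) -> E -> R).

(** The shape required of P in a single chart by [diff_op_order], stated for an
    operator on functions of R^n. *)
Definition local_diff_op m Q := exists a : {ffun 'I_n -> 'I_m.+1} -> E -> R,
  (forall al, smooth_on U (a al)) /\
  forall f, smooth_on U f -> forall x, U x -> Q f x =
    \sum_(al : {ffun 'I_n -> 'I_m.+1} | (\sum_i al i <= m)%N)
      a al x * Dmulti (fun i => al i) f x.

Lemma local_diff_op_ext m Q Q' :
  (forall f, smooth_on U f -> forall x, U x -> Q f x = Q' f x) ->
  local_diff_op m Q -> local_diff_op m Q'.
Proof.
move=> QQ' [a [sa QE]]; exists a; split=> // f sf x Ux.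
by rewrite -QQ' // QE.
Qed.

Lemma local_diff_op_sum m (J : finType) (P : pred J) (Q : J -> (E -> R) -> E -> R) :
  (forall j, P j -> local_diff_op m (Q j)) ->
  local_diff_op m (fun f x => \sum_(j | P j) Q j f x).
Proof.
move=> HQ.
have HQ' j : exists a : {ffun 'I_n -> 'I_m.+1} -> E -> R,
    (forall al, smooth_on U (a al)) /\ (P j ->
    forall f, smooth_on U f -> forall x, U x -> Q j f x =
    \sum_(al : {ffun 'I_n -> 'I_m.+1} | (\sum_i al i <= m)%N)
      a al x * Dmulti (fun i => al i) f x).
  case Pj: (P j); first by have [a [sa Ha]] := HQ j Pj; exists a.
  by exists (fun _ => fun=> 0); split=> // al k; exact: Ck_cst.
have [a aP] := choice HQ'.
exists (fun al x => \sum_(j | P j) a j al x); split=> [al k|f sf x Ux].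
  by apply: Ck_sum => // j _; exact: (aP j).1.
under eq_bigr => j Pj do rewrite ((aP j).2 Pj f sf x Ux).
rewrite exchange_big /=; apply: eq_bigr => al _.
by rewrite mulr_suml.
Qed.

Lemma local_diff_op_term m (be : 'I_n -> nat) (c : E -> R) : smooth_on U c ->
  (\sum_i be i <= m)%N -> local_diff_op m (fun f x => c x * Dmulti be f x).
Proof.
move=> sc bem.
have bei i : (be i < m.+1)%N.
  by rewrite ltnS (leq_trans _ bem) // (bigD1 i) //= leq_addr.
pose B : {ffun 'I_n -> 'I_m.+1} := [ffun i => Ordinal (bei i)].
have BE : (fun i => nat_of_ord (B i)) = be by apply/funext => i; rewrite ffunE.
exists (fun al => if al == B then c else fun=> 0); split=> [al|f sf x Ux].
  by case: ifP => // _ k; exact: Ck_cst.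
rewrite (bigD1 B) /=; last by rewrite (eq_bigr be) // => i _; rewrite ffunE.
rewrite eqxx BE big1 ?addr0 // => al /andP[_ /negbTE ->].
by rewrite mul0r.
Qed.

(** By the Leibniz rule, d_i applied to a D^al is the sum of (d_i a) D^al and
    a D^(al + e_i). *)
Lemma local_diff_op_derive m i (b : E -> R) Q : smooth_on U b ->
  local_diff_op m Q -> local_diff_op m.+1 (fun f x => b x * partial i (Q f) x).
Proof.
move=> sb [a [sa QE]].
have sD (be : 'I_n -> nat) f : smooth_on U f -> smooth_on U (Dmulti be f).
  by move=> sf; rewrite Dmulti_word; exact: word_smooth.
pose Q1 f x :=
  \sum_(al : {ffun 'I_n -> 'I_m.+1} | (\sum_i al i <= m)%N)
     (b \* partial i (a al)) x * Dmulti (fun i => al i) f x.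
pose Q2 f x :=
  \sum_(al : {ffun 'I_n -> 'I_m.+1} | (\sum_i al i <= m)%N)
     (b \* a al) x * Dmulti (fun j => (al j + (j == i))%N) f x.
apply: (@local_diff_op_ext _ (fun f x =>
    \sum_(j : bool) (if j then Q1 else Q2) f x)).
  move=> f sf x Ux; rewrite big_bool /= /Q1 /Q2 -big_split /=.
  pose t (al : {ffun 'I_n -> 'I_m.+1}) y := a al y * Dmulti (fun i => al i) f y.
  pose dt (al : {ffun 'I_n -> 'I_m.+1}) :=
    a al x * Dmulti (fun j => (al j + (j == i))%N) f x
      + Dmulti (fun i => al i) f x * partial i (a al) x.
  have -> : partial i (Q f) x = partial i
      (fun y => \sum_(al : {ffun 'I_n -> 'I_m.+1} | (\sum_i al i <= m)%N) t al y) x.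
    apply: near_eq_derive.
    by apply: filterS (open_nbhs_nbhs (conj oU Ux)) => y Uy; exact: QE.
  have dtE al : is_derive x (delta_mx 0 i) (t al) (dt al).
    rewrite /dt -(partial_Dmulti i _ oU sf Ux).
    apply: is_deriveM; apply: derivableP.
    - exact: ((sa al 1%N).2 i).1.
    - exact: ((sD _ f sf 1%N).2 i).1.
  have dsum (r : seq {ffun 'I_n -> 'I_m.+1}) (P : pred {ffun 'I_n -> 'I_m.+1}) :
     is_derive x (delta_mx 0 i) (fun y => \sum_(al <- r | P al) t al y)
       (\sum_(al <- r | P al) dt al).
    elim: r => [|al r IH].
      rewrite (_ : (fun y => _) = fun=> 0).
        by rewrite big_nil; exact: is_derive_cst.
      by apply/funext => y; rewrite big_nil.
    rewrite big_cons; case Pal: (P al).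
      rewrite (_ : (fun y => _) = t al + (fun y => \sum_(al <- r | P al) t al y)).
        exact: is_deriveD.
      by apply/funext => y; rewrite big_cons Pal.
    rewrite (_ : (fun y => _) = fun y => \sum_(al <- r | P al) t al y) //.
    by apply/funext => y; rewrite big_cons Pal.
  have [_ Dsum] := dsum (index_enum _) (fun al => (\sum_i al i <= m)%N).
  rewrite [partial i _ x]Dsum mulr_sumr; apply: eq_bigr => al _ /=.
  by rewrite /dt; ring.
apply: local_diff_op_sum => -[] _; apply: local_diff_op_sum => al alm.
- apply: local_diff_op_term; last exact: leqW.
  by move=> k; apply: CkM => //; exact: smooth_on_partial.
- apply: local_diff_op_term; first by move=> k; apply: CkM => //; exact: sa.
  have -> : (\sum_j (al j + (j == i)) = (\sum_j al j).+1)%N.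
    have s1 : (\sum_(j < n) (j == i) = 1)%N.
      by rewrite (bigD1 i) //= eqxx big1 // => j /negbTE ->.
    by rewrite big_split /= s1 addn1.
  by rewrite ltnS.
Qed.

End LocalDiffOp.

(** * Moderate families and compactness *)

(** A property of sets which is inherited by subsets, stable under finite unions
    and true near each point of K holds for K: otherwise the sets S for which K \ S
    has the property form a proper filter containing K with no cluster point in K. *)
Lemma compact_union_ind (T : topologicalType) (K : set T) (P : set T -> Prop) :
  compact K -> P set0 -> (forall S S', S' `<=` S -> P S -> P S') ->
  (forall S S', P S -> P S' -> P (S `|` S')) ->
  (forall p, K p -> exists2 W, nbhs p W & P W) -> P K.
Proof.
move=> cK P0 Psub PU Ploc; apply: contrapT => nPK.
pose F : set_system T := [set S | P (K `\` S)].
have FF : ProperFilter F.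
  split; first by rewrite /F /= setD0.
  split; rewrite /F /=.
  - by rewrite setDT.
  - move=> S S' PS PS'; apply: Psub (PU _ _ PS PS') => p [Kp nSS'].
    have [Sp|nSp] := pselect (S p); [right|left]; split=> // S'p.
    exact: nSS'.
  - by move=> S S' SS'; apply: Psub => p [Kp nS'p]; split=> // /SS'.
have FK : F K by rewrite /F /= setDv.
have [p [Kp clp]] := cK F FF FK.
have [W pW PW] := Ploc p Kp.
have FW : F (~` W) by apply: Psub PW => q [_ /contrapT].
by have [q []] := clp _ _ FW pW.
Qed.

Section SupNorm.
Context {R : realType} {T : topologicalType}.
Implicit Types (K : set T) (g : T -> R).

Lemma sup_norm_le K g (B : R) : 0 <= B ->
  (forall p, K p -> `|g p| <= B) -> sup_norm K g <= B.
Proof.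
move=> B0 H; rewrite /sup_norm.
have [->|/set0P K0] := eqVneq K set0; first by rewrite image_set0 sup0.
by apply: ge_sup; [exact: image_nonempty|move=> _ [p Kp <-]; exact: H].
Qed.

Lemma le_sup_norm K g p : compact K -> (forall q, K q -> {for q, continuous g}) ->
  K p -> `|g p| <= sup_norm K g.
Proof.
move=> cK cg Kp.
have cK' : compact [set `|g q| | q in K].
  apply: continuous_compact cK; apply: continuous_in_subspaceT => q /set_mem Kq.
  by apply: continuous_comp; [exact: cg|exact: norm_continuous].
have := @compact_has_sup R _ (image_nonempty _ (ex_intro _ p Kp)) cK'.
by move=> [_ /ub_le_sup]; apply; exists p.
Qed.

Lemma sup_norm_ge0 K g : 0 <= sup_norm K g.
Proof.
set S := [set `|g q| | q in K].
have [[[_ [q Kq _]] Sub]|/sup_out S0] := pselect (has_sup S); last first.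
  by rewrite [sup_norm K g]S0.
by apply: le_trans (normr_ge0 (g q)) (ub_le_sup Sub _); exists q.
Qed.

End SupNorm.

Section Moderation.
Context {R : realType}.

(** The pointwise form of [growth_order] for [sup_norm].  Unlike the supremum,
    which is 0 by convention on unbounded sets, it passes to arbitrary subsets. *)
Definition moderate_on (T : Type) (N : nat) (S : set T) (v : @epsI R -> T -> R) :=
  exists C : R, \forall e \near @eps_to0 R,
    forall p, S p -> `|v e p| <= C * (val e) ^- N.

Lemma eps_gt0 (e : @epsI R) : 0 < val e.
Proof. by case: e => e /= /andP[]. Qed.

Lemma eps_le1 (e : @epsI R) : val e <= 1.
Proof. by case: e => e /= /andP[]. Qed.

Lemma epsXN_ge0 (e : @epsI R) N : 0 <= (val e) ^- N.
Proof. by rewrite invr_ge0 exprn_ge0 // ltW // eps_gt0. Qed.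

Lemma moderate_onP (T : Type) N (S : set T) v : moderate_on N S v ->
  exists2 C : R, 0 < C & \forall e \near @eps_to0 R,
    forall p, S p -> `|v e p| <= C * (val e) ^- N.
Proof.
move=> [C HC]; exists (`|C| + 1); first by rewrite ltr_wpDl.
apply: filterS HC => e He p Sp; apply: le_trans (He p Sp) _.
by rewrite ler_wpM2r ?epsXN_ge0 // (le_trans (ler_norm C)) // lerDl.
Qed.

Lemma moderate_on0 (T : Type) N (v : @epsI R -> T -> R) : moderate_on N set0 v.
Proof. by exists 0; apply: nearW => e p []. Qed.

Lemma moderate_on_sub (T : Type) N (S S' : set T) v : S' `<=` S ->
  moderate_on N S v -> moderate_on N S' v.
Proof.
by move=> SS' [C HC]; exists C; apply: filterS HC => e He p /SS'; exact: He.
Qed.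

Lemma moderate_on_leq (T : Type) N N' (S : set T) v : (N <= N')%N ->
  moderate_on N S v -> moderate_on N' S v.
Proof.
move=> NN' /moderate_onP[C C0 HC]; exists C; apply: filterS HC => e He p Sp.
apply: le_trans (He p Sp) _; rewrite ler_wpM2l ?(ltW C0) //.
have X0 k : 0 < val e ^+ k by rewrite exprn_gt0 ?eps_gt0.
rewrite (lef_pV2 (X0 N) (X0 N')).
by apply: ler_wiXn2l => //; [rewrite ltW // eps_gt0|exact: eps_le1].
Qed.

Lemma moderate_on_eq (T : Type) N (S : set T) v v' :
  (forall e p, S p -> v e p = v' e p) -> moderate_on N S v -> moderate_on N S v'.
Proof.
move=> vv' [C HC]; exists C; apply: filterS HC => e He p Sp.
by rewrite -vv' // He.
Qed.

Lemma moderate_on_pullback (T T' : Type) N (S : set T) (S' : set T')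
    (h : T' -> T) v :
  (forall q, S' q -> S (h q)) -> moderate_on N S v ->
  moderate_on N S' (fun e => v e \o h).
Proof.
by move=> Sh [C HC]; exists C; apply: filterS HC => e He q /Sh; exact: He.
Qed.

Lemma moderate_onU (T : Type) N N' (S S' : set T) v :
  moderate_on N S v -> moderate_on N' S' v -> moderate_on (maxn N N') (S `|` S') v.
Proof.
move=> /(moderate_on_leq (leq_maxl N N'))/moderate_onP[C C0 HC].
move=> /(moderate_on_leq (leq_maxr N N'))/moderate_onP[C' C'0 HC'].
exists (C + C'); apply: filterS2 HC HC' => e He He' p Sp.
case: Sp => Sp; [apply: le_trans (He p Sp) _|apply: le_trans (He' p Sp) _];
  by rewrite ler_wpM2r ?epsXN_ge0 // ?lerDl ?lerDr ltW.
Qed.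

(** The coefficients are absorbed by the constant: the exponent does not depend on
    them. *)
Lemma moderate_on_lincomb (T : Type) (J : finType) (P : pred J) (N : J -> nat)
    (S : set T) (a : J -> T -> R) (w : J -> @epsI R -> T -> R) :
  (forall j, exists M : R, forall p, S p -> `|a j p| <= M) ->
  (forall j, P j -> moderate_on (N j) S (w j)) ->
  moderate_on (\max_(j | P j) N j) S (fun e p => \sum_(j | P j) a j p * w j e p).
Proof.
move=> Ha Hw; set NM := \max_(j | P j) N j.
have Hterm j : P j -> exists2 C : R, 0 < C &
    \forall e \near @eps_to0 R, forall p, S p ->
      `|a j p * w j e p| <= C * (val e) ^- NM.
  move=> Pj; have [M HM] := Ha j.
  have /(moderate_on_leq (leq_bigmax_cond j Pj))/moderate_onP[C C0 HC] := Hw j Pj.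
  exists ((`|M| + 1) * C); first by rewrite mulr_gt0 // ltr_wpDl.
  apply: filterS HC => e He p Sp; rewrite normrM -mulrA.
  apply: ler_pM => //; last exact: He.
  by rewrite (le_trans (HM p Sp)) // (le_trans (ler_norm M)) // lerDl.
suff : forall r : seq J, exists2 C : R, 0 < C &
    \forall e \near @eps_to0 R, forall p, S p ->
      `|\sum_(j <- r | P j) a j p * w j e p| <= C * (val e) ^- NM.
  by move=> /(_ (index_enum J))[C _ HC]; exists C.
elim=> [|j r [C C0 HC]].
  exists 1 => //; apply: nearW => e p _.
  by rewrite big_nil normr0 mul1r epsXN_ge0.
case Pj: (P j); last first.
  by exists C => //; apply: filterS HC => e He p Sp; rewrite big_cons Pj; exact: He.
have [C' C'0 HC'] := Hterm j Pj.
exists (C' + C); first exact: addr_gt0.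
apply: filterS2 HC HC' => e He He' p Sp; rewrite big_cons Pj mulrDl.
by apply: le_trans (ler_normD _ _) _; apply: lerD; [exact: He'|exact: He].
Qed.

Lemma moderate_on_growth (T : topologicalType) N (K : set T) v :
  moderate_on N K v -> growth_order N (fun e => sup_norm K (v e)).
Proof.
move=> /moderate_onP[C C0 HC]; apply/eqO_exP; exists C => //.
apply: filterS HC => e He; rewrite (ger0_norm (sup_norm_ge0 _ _)).
rewrite (ger0_norm (epsXN_ge0 e N)).
by apply: sup_norm_le => //; rewrite mulr_ge0 ?epsXN_ge0 // ltW.
Qed.

Lemma growth_moderate_on (T : topologicalType) N (K : set T) v : compact K ->
  (forall e p, K p -> {for p, continuous (v e)}) ->
  growth_order N (fun e => sup_norm K (v e)) -> moderate_on N K v.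
Proof.
move=> cK cv /eqO_exP[C C0 HC]; exists C; apply: filterS HC => e He p Kp.
rewrite (ger0_norm (sup_norm_ge0 _ _)) (ger0_norm (epsXN_ge0 e N)) in He.
exact: le_trans (le_sup_norm cK (cv e) Kp) He.
Qed.

End Moderation.

(** * Charts *)

Section Charts.
Context {R : realType} {n : nat} {X : topologicalType}.
Local Notation E := 'rV[R]_n.
Implicit Types (c d : chart R n X).

Lemma cinv_cdom c y : cimg c y -> cdom c (cinv c y).
Proof. by move=> [p cp <-]; rewrite cmapK ?inE. Qed.

Lemma cinvK c y : cimg c y -> cmap c (cinv c y) = y.
Proof. by move=> [p cp <-]; rewrite cmapK ?inE. Qed.

Lemma cmap_cimg c p : cdom c p -> cimg c (cmap c p).
Proof. by move=> cp; exists p. Qed.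

(** The inverse of a chart is continuous only on the open image of the chart, whence
    the first conjunct. *)
Lemma open_cinv c (O : set X) : open O -> open [set y | cimg c y /\ O (cinv c y)].
Proof.
move=> oO; rewrite openE => y [cy Oy].
have nO : \forall z \near y, O (cinv c z).
  by apply: (cinv_continuous (mem_set cy)); exact: open_nbhs_nbhs.
have nc : \forall z \near y, cimg c z.
  by apply: open_nbhs_nbhs; split=> //; exact: cimg_open.
by apply: filterS2 nc nO.
Qed.

Lemma cimg_overlap c d :
  cmap c @` (cdom c `&` cdom d) = [set y | cimg c y /\ cdom d (cinv c y)].
Proof.
apply/seteqP; split=> [_ [p [cp dp] <-]|y [cy dy]].
  by split; [exact: cmap_cimg|rewrite cmapK ?inE].
by exists (cinv c y); [split=> //; exact: cinv_cdom|exact: cinvK].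
Qed.

Lemma open_overlap c d : open (cmap c @` (cdom c `&` cdom d)).
Proof. by rewrite cimg_overlap; apply: open_cinv; exact: cdom_open. Qed.

Lemma compact_cinv c (K : set E) : compact K -> K `<=` cimg c ->
  compact (cinv c @` K).
Proof.
move=> cK Kc; apply: continuous_compact cK.
by apply: continuous_in_subspaceT => y /set_mem/Kc/mem_set; exact: cinv_continuous.
Qed.

Lemma compact_closed_ball_norm (y : E) (r : R) : compact [set z : E | `|z - y| <= r].
Proof.
apply: bounded_closed_compact.
  exists (`|y| + r); split; first exact: num_real.
  move=> M ltM z /= zr; apply: le_trans (ltW ltM).
  have := ler_normD (z - y) y; rewrite subrK => /le_trans; apply.
  by rewrite addrC lerD2l.
have -> : [set z : E | `|z - y| <= r] =
  (fun z : E => `|z - y|) @^-1` [set t | t <= r] by [].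
apply: closed_comp; last exact: closed_le.
move=> z _; apply: continuous_comp; last exact: norm_continuous.
by apply: continuousB; [exact: cvg_id|exact: cst_continuous].
Qed.

Lemma closed_ball_in (U : set E) y : open U -> U y ->
  exists2 r : R, 0 < r & [set z : E | `|z - y| <= r] `<=` U.
Proof.
move=> oU Uy; have /nbhs_ballP[r /= r0 rU] := open_nbhs_nbhs (conj oU Uy).
exists (r / 2); first by rewrite divr_gt0.
move=> z /= zr; apply: rU; rewrite -ball_normE /ball_ /= distrC.
by apply: le_lt_trans zr _; rewrite ltr_pdivrMr // ltr_pMr // ltr1n.
Qed.

End Charts.

(** * Lie derivatives and the three spaces of nets *)

Section SmoothManifold.
Context {R : realType} {n : nat} {X : topologicalType}.
Variable A : smooth_structure R n X.
Local Notation E := 'rV[R]_n.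
Implicit Types (f g : smooth_fun A) (c d : chart R n X).

Lemma smooth_fun_continuous f : continuous f.
Proof.
move=> p; have [c Ac cp] := charts_cover A p.
have E1 : \forall q \near p, (local_repr f c \o cmap c) q = f q.
  have : \forall q \near p, cdom c q.
    by apply: open_nbhs_nbhs; split=> //; exact: cdom_open.
  by apply: filterS => q cq; rewrite /local_repr /= cmapK ?inE.
have C : {for p, continuous (local_repr f c \o cmap c)}.
  apply: continuous_comp; first by apply: cmap_continuous; rewrite inE.
  by apply: (smooth_valP f Ac 0%N).1; apply/mem_set/cmap_cimg.
have fp := nbhs_singleton E1.
rewrite /continuous_at -fp; apply: cvg_trans C; exact: near_eq_cvg.
Qed.

Lemma lie_linear (xi : vector_field A) : linear (lie xi).
Proof.
move=> a f g; apply/val_inj/funext => p.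
exact: (linearP (vf_val xi p) a f g).
Qed.

Definition lie_word (xi : seq (vector_field A)) (f : smooth_fun A) : smooth_fun A :=
  foldr (@lie _ _ _ A) f xi.

Lemma lie_word_linear xi : linear (lie_word xi).
Proof.
elim: xi => //= xi s IH a f g.
by rewrite /lie_word /= -/(lie_word _ _) IH lie_linear.
Qed.

HB.instance Definition _ xi :=
  GRing.isLinear.Build R (smooth_fun A) (smooth_fun A) *:%R (lie_word xi)
    (lie_word_linear xi).

(** In a chart each field is a first-order operator, and composing with it raises
    the order by one ([local_diff_op_derive]). *)
Lemma lie_word_local (xi : seq (vector_field A)) c : charts A c ->
  exists Q, local_diff_op (cimg c) (size xi) Q /\
    forall f y, cimg c y -> lie_word xi f (cinv c y) = Q (local_repr f c) y.
Proof.
move=> Ac; have oc : open (cimg c) by exact: cimg_open.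
elim: xi => [|xi s [Q [LQ HQ]]].
  exists (fun (f : E -> R) x => 1 * Dmulti (fun=> 0%N) f x); split.
    apply: local_diff_op_term; last by rewrite big1.
    by move=> k; exact: Ck_cst.
  move=> f y cy; rewrite mul1r /Dmulti /=.
  by elim: (enum 'I_n).
have [a [sa Ha]] := vf_smooth xi Ac.
exists (fun (f : E -> R) x => \sum_i a i x * partial i (Q f) x); split.
  by apply: local_diff_op_sum => // i _; apply: local_diff_op_derive.
move=> f y cy /=; rewrite (Ha _ (cinv_cdom cy)) cinvK //.
apply: eq_bigr => i _; congr (_ * _); apply: near_eq_derive.
by apply: filterS (open_nbhs_nbhs (conj oc cy)) => z cz; exact: HQ.
Qed.

Lemma lie_word_diff_op xi : diff_op_order (size xi) (lie_word xi).
Proof.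
move=> c Ac; have [Q [[a [sa HQ]] Qxi]] := lie_word_local xi Ac.
exists a; split=> // f p cp; rewrite -{1}(cmapK (mem_set cp)).
rewrite Qxi; last exact: cmap_cimg.
by apply: HQ; [exact: smooth_valP Ac|exact: cmap_cimg].
Qed.

(** The exponent is chosen before P.  Locally it is the largest exponent of the
    derivatives of u of order at most m on a closed ball in a chart; P only
    contributes coefficients, which are bounded on the ball. *)
Lemma EM_chart_diff_op (u : net A) (K : set X) m : EM_chart A u -> compact K ->
  exists N, forall P : {linear smooth_fun A -> smooth_fun A},
    diff_op_order m P -> moderate_on N K (fun e => P (u e) : X -> R).
Proof.
move=> Mu cK.
apply: (@compact_union_ind _ K (fun S => exists N,
  forall P : {linear smooth_fun A -> smooth_fun A},
    diff_op_order m P -> moderate_on N S (fun e => P (u e) : X -> R))) => //.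
- by exists 0%N => P _; exact: moderate_on0.
- by move=> S S' SS' [N HN]; exists N => P /HN; exact: moderate_on_sub.
- move=> S S' [N HN] [N' HN']; exists (maxn N N') => P oP.
  by apply: moderate_onU; [exact: HN|exact: HN'].
move=> p _; have [c Ac cp] := charts_cover A p.
have [su Mc] := Mu c Ac.
have cy := cmap_cimg cp; set y := cmap c p in cy.
have [r r0 Bc] := closed_ball_in (@cimg_open _ _ _ c) cy.
set B := [set z | _] in Bc; have cB : compact B := @compact_closed_ball_norm R n y r.
have HB (al : {ffun 'I_n -> 'I_m.+1}) : exists N,
    moderate_on N B (fun e => Dmulti (fun i => al i) (local_repr (u e) c)).
  have [N HN] := Mc B (fun i => nat_of_ord (al i)) cB Bc; exists N.
  apply: growth_moderate_on => // e z Bz; rewrite Dmulti_word.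
  by apply: (word_smooth _ (su e) 0%N).1; exact/mem_set/Bc.
have [N HN] := choice HB.
exists (cdom c `&` cmap c @^-1` B).
  apply: filterI; first by apply: open_nbhs_nbhs; split=> //; exact: cdom_open.
  apply: (cmap_continuous (mem_set cp)); rewrite -/y.
  apply/nbhs_ballP; exists r => // z; rewrite -ball_normE /ball_ /= distrC.
  exact: ltW.
exists (\max_(al : {ffun 'I_n -> 'I_m.+1} | (\sum_i al i <= m)%N) N al) => P oP.
have [a [sa Pa]] := oP c Ac.
pose w e z := \sum_(al : {ffun 'I_n -> 'I_m.+1} | (\sum_i al i <= m)%N)
  a al z * Dmulti (fun i => al i) (local_repr (u e) c) z.
have L : moderate_on
    (\max_(al : {ffun 'I_n -> 'I_m.+1} | (\sum_i al i <= m)%N) N al) B w.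
  apply: moderate_on_lincomb => [al|al _]; last exact: HN.
  exists (sup_norm B (a al)) => z Bz; apply: le_sup_norm => // z' Bz'.
  by apply: (sa al 0%N).1; exact/mem_set/Bc.
apply: (@moderate_on_eq _ _ _ _ (fun e => w e \o cmap c)).
  by move=> e q [cq _]; rewrite Pa.
by apply: moderate_on_pullback L => q [].
Qed.

Section Cutoff.
Hypothesis hX : hausdorff_space X.
Variable c : chart R n X.
Hypothesis Ac : charts A c.
Variables (chi : E -> R) (B : set E) (i : 'I_n).
Hypothesis schi : smooth_on setT chi.
Hypothesis cB : compact B.
Hypothesis Bc : B `<=` cimg c.
Hypothesis chiB : forall y, chi y != 0 -> B y.

(** The value at p of the field chi d_i of the chart c, extended by 0. *)
Definition cutoff_partial (p : X) (f : smooth_fun A) : R :=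
  if `[< cdom c p >] then chi (cmap c p) * partial i (local_repr f c) (cmap c p)
  else 0.

Lemma derivable_local_repr f y : cimg c y ->
  derivable (local_repr f c) y (delta_mx 0 i).
Proof. exact: ((smooth_valP f Ac 1%N).2 i).1. Qed.

Lemma cutoff_partial_scalar p : scalar (cutoff_partial p).
Proof.
move=> a f g; rewrite /cutoff_partial.
case: asboolP => [cp|_]; last by rewrite mulr0 addr0.
have df := @derivable_local_repr f _ (cmap_cimg cp).
have dg := @derivable_local_repr g _ (cmap_cimg cp).
have -> : partial i (local_repr (a *: f + g) c) (cmap c p) =
    a * partial i (local_repr f c) (cmap c p)
      + partial i (local_repr g c) (cmap c p).
  have := is_deriveD (is_deriveZ a (derivableP df)) (derivableP dg).
  by move=> [_ <-].
by rewrite mulrDr mulrCA.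
Qed.

Definition cutoff_lin p : {scalar smooth_fun A} :=
  HB.pack_for {scalar smooth_fun A} (cutoff_partial p)
    (GRing.isLinear.Build R (smooth_fun A) R *%R (cutoff_partial p)
      (cutoff_partial_scalar p)).

Lemma cutoff_leibniz p f g :
  cutoff_lin p (f * g) = f p * cutoff_lin p g + cutoff_lin p f * g p.
Proof.
rewrite /= /cutoff_partial.
case: asboolP => [cp|_]; last by rewrite mulr0 mul0r addr0.
have df := @derivable_local_repr f _ (cmap_cimg cp).
have dg := @derivable_local_repr g _ (cmap_cimg cp).
have [_] := is_deriveM (derivableP df) (derivableP dg).
rewrite -[LHS]/(partial i (local_repr (f * g) c) (cmap c p)) => ->.
rewrite !scaleRE -/(partial i _ _) -/(partial i _ _).
rewrite /local_repr /= cmapK ?inE //.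
by ring.
Qed.

Definition cutoff_tangent p : tangent A p := Tangent (@cutoff_leibniz p).

(** On the overlap with c the components in the chart d are given by the chain rule.
    The remaining points of d lie outside the image of the compact set B, which is
    closed because X is Hausdorff; near them the components vanish.  These two open
    sets cover the image of d. *)
Lemma cutoff_smooth d : charts A d ->
  exists a : 'I_n -> E -> R,
    (forall j, smooth_on (cimg d) (a j)) /\
    forall p, cdom d p -> forall f : smooth_fun A,
      cutoff_tangent p f =
      \sum_(j < n) a j (cmap d p) * partial j (local_repr f d) (cmap d p).
Proof.
move=> Ad.
have [s_cd s_dc] := charts_compatible Ac Ad.
pose phi := cmap d \o cinv c; pose theta := cmap c \o cinv d.
pose Oc := cmap c @` (cdom c `&` cdom d).
pose Od := cmap d @` (cdom c `&` cdom d).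
have oOc : open Oc by exact: open_overlap.
have OdE : Od = [set y | cimg d y /\ cdom c (cinv d y)].
  by rewrite /Od setIC cimg_overlap.
have oOd : open Od by rewrite /Od setIC; exact: open_overlap.
exists (fun j y => if `[< cdom c (cinv d y) >]
    then chi (theta y) * partial i (fun x => phi x 0 j) (theta y) else 0).
split=> [j k|p dp f].
- apply: Ck_local => y dy; have [cy|ncy] := pselect (cdom c (cinv d y)).
    exists Od; split=> //; first by rewrite OdE.
    pose b := chi \* partial i (fun x => phi x 0 j).
    apply: (@Ck_ext _ _ _ _ (b \o theta)) => //.
      by move=> z; rewrite OdE => -[dz cz]; case: asboolP.
    apply: (@Ck_comp _ _ _ _ Oc) => //.
    + by move=> _ [q [cq dq] <-]; exists q => //; rewrite /theta /= cmapK ?inE.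
    + by move=> l; exact: s_dc.
    + apply: CkM => //; first exact: Ck_sub (schi k).
      exact: smooth_on_partial (s_cd j) k.
  (* Off the overlap: a neighbourhood avoiding the support of chi. *)
  pose L := cinv c @` B.
  have cL : closed L by apply: compact_closed => //; exact: compact_cinv.
  exists [set z | cimg d z /\ (~` L) (cinv d z)]; split.
  + by apply: open_cinv; exact: closed_openC.
  + by split=> // -[x Bx xy]; apply: ncy; rewrite -xy; exact/cinv_cdom/Bc.
  apply: Ck_ext (Ck_cst k _ 0) => //; first by apply: open_cinv; exact: closed_openC.
  move=> z [dz nLz]; case: asboolP => // cz.
  have [->|/chiB Bz] := eqVneq (chi (theta z)) 0; first by rewrite mul0r.
  by case: nLz; exists (theta z) => //; rewrite /theta /= cmapK ?inE.
- rewrite /= /cutoff_partial !cmapK ?inE //.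
  case: asboolP => [cp|_]; last by rewrite big1 // => j _; rewrite mul0r.
  have Ocx : Oc (cmap c p) by exists p.
  have phix : phi (cmap c p) = cmap d p by rewrite /phi /= cmapK ?inE.
  have C1 : Ck 1 (cimg d) (local_repr f d) := smooth_valP f Ad 1%N.
  have dphi j : derivable (fun x => phi x 0 j) (cmap c p) (delta_mx 0 i).
    exact: ((s_cd j 1%N).2 i).1.
  have Up : cimg d (phi (cmap c p)) by rewrite phix; exact: cmap_cimg.
  have [_ Dc] := is_derive_comp (@cimg_open _ _ _ d) Up C1 dphi.
  have -> : partial i (local_repr f c) (cmap c p) =
      'D_(delta_mx 0 i) (local_repr f d \o phi) (cmap c p).
    apply: near_eq_derive.
    apply: filterS (open_nbhs_nbhs (conj oOc Ocx)) => _ [q [cq dq] <-].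
    by rewrite /local_repr /phi /= !cmapK ?inE.
  rewrite Dc mulr_sumr; apply: eq_bigr => j _.
  by rewrite /theta /= cmapK ?inE // phix mulrA.
Qed.

Definition cutoff_field : vector_field A := VectorField cutoff_smooth.

Lemma cutoff_fieldE f y : cimg c y ->
  cutoff_field (cinv c y) f = chi y * partial i (local_repr f c) y.
Proof.
move=> cy; rewrite /= /cutoff_partial cinvK //.
by case: asboolP => // -[]; exact: cinv_cdom.
Qed.

End Cutoff.

(** Near y the bump function is 1, so each field [cutoff_field] acts there as a
    partial derivative, and so does any word in them as all operators are local. *)
Lemma word_partial_lie c y (w : seq 'I_n) : hausdorff_space X -> charts A c ->
  cimg c y ->
  exists (xi : seq (vector_field A)) (V : set E), [/\ open V, V y &
    forall f z, V z -> lie_word xi f (cinv c z) = word_partial w (local_repr f c) z].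
Proof.
move=> hX Ac cy; have [r r0 Bc] := closed_ball_in (@cimg_open _ _ _ c) cy.
have cB := @compact_closed_ball_norm R n y r.
have [chi [schi chi1 chiB]] := exists_bump y r0.
pose F i := cutoff_field hX Ac i schi cB Bc chiB.
pose V := (cimg c `&` [set z | chi z = 1])°.
have nV : nbhs y (cimg c `&` [set z | chi z = 1]).
  by apply: filterI => //; apply: open_nbhs_nbhs; split=> //; exact: cimg_open.
exists (map F w), V; split; [exact: open_interior|exact: nV|].
move=> f; elim: w => [|i w IH] z Vz //=.
have [cz chiz] := interior_subset Vz.
rewrite [LHS](cutoff_fieldE hX Ac i schi cB Bc chiB _ cz) chiz mul1r.
apply: near_eq_derive.
by apply: filterS (open_nbhs_nbhs (conj (@open_interior _ _) Vz)) => x Vx; exact: IH.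
Qed.

(** The exponent may depend on the fields here: only finitely many words are used,
    one for each of the neighbourhoods covering the compact set. *)
Lemma lie_bounds_EM_chart (u : net A) : hausdorff_space X ->
  (forall (K : set X) (xi : seq (vector_field A)), compact K ->
    exists N, growth_order N (fun e => sup_norm K (lie_word xi (u e)))) ->
  EM_chart A u.
Proof.
move=> hX Hu c Ac; split=> [e|K al cK Kc]; first exact: smooth_valP Ac.
(* Intersecting with K gives a property that passes to subsets and still only
   involves points of K, where the hypothesis applies. *)
suff [N HN] : exists N, moderate_on N (K `&` K)
    (fun e => Dmulti al (local_repr (u e) c)).
  by exists N; apply: moderate_on_growth; rewrite setIid in HN.
apply: (@compact_union_ind _ K (fun S => exists N, moderate_on N (S `&` K)
    (fun e => Dmulti al (local_repr (u e) c)))) => //.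
- by exists 0%N; rewrite set0I; exact: moderate_on0.
- move=> S S' SS' [N HN]; exists N; apply: moderate_on_sub HN.
  by apply: setSI.
- move=> S S' [N HN] [N' HN']; exists (maxn N N'); rewrite setIUl.
  exact: moderate_onU.
move=> y Ky.
have [xi [V [oV Vy HV]]] := word_partial_lie
  (flatten [seq nseq (al i) i | i <- enum 'I_n]) hX Ac (Kc y Ky).
exists V; first exact: open_nbhs_nbhs.
have [N HN] := Hu _ xi (compact_cinv cK Kc); exists N.
have M : moderate_on N (cinv c @` K) (fun e => lie_word xi (u e) : X -> R).
  apply: growth_moderate_on HN; first exact: compact_cinv.
  by move=> e p _; exact: smooth_fun_continuous.
apply: (@moderate_on_eq _ _ _ _ (fun e => lie_word xi (u e) \o cinv c)).
  by move=> e z [Vz _]; rewrite Dmulti_word /= HV.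
by apply: moderate_on_pullback M => z [_ Kz]; exists z.
Qed.

End SmoothManifold.

Theorem lemma1 (R : realType) (n : nat) (X : topologicalType)
    (A : smooth_structure R n X)
    (hX : hausdorff_space X) (pX : paracompact X) :
  EM_diff_op A = EM_lie A /\
  EM_lie A = EM_chart A.
Proof.
have op_chart : EM_diff_op A `<=` EM_chart A.
  move=> u Mu; apply: lie_bounds_EM_chart => // K xi cK.
  by apply: (Mu K (lie_word xi)) => //; exists (size xi); exact: lie_word_diff_op.
have lie_chart : EM_lie A `<=` EM_chart A.
  move=> u Mu; apply: lie_bounds_EM_chart => // K xi cK.
  by have [N /(_ (in_tuple xi)) HN] := Mu K (size xi) cK; exists N.
have chart_op : EM_chart A `<=` EM_diff_op A.
  move=> u Mu K P cK [m oP]; have [N HN] := EM_chart_diff_op m Mu cK.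
  by exists N; apply: moderate_on_growth; exact: HN.
have chart_lie : EM_chart A `<=` EM_lie A.
  move=> u Mu K k cK; have [N HN] := EM_chart_diff_op k Mu cK.
  exists N => xi; apply: moderate_on_growth; apply: (HN (lie_word xi)).
  by rewrite -[X in diff_op_order X](size_tuple xi); exact: lie_word_diff_op.
have E2 : EM_lie A = EM_chart A by apply/seteqP.
by rewrite E2; split=> //; apply/seteqP.
Qed.
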